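(* (i) For every prime $p$ with $5\le p\le 599$ and $p\notin\{11,83,103,163,397\}$, the statement $\mathrm{ML}(p)$ is false. (ii) For $p\in\{83,397\}$ the statement $\mathrm{ML}(p)$ is true; more precisely, with $Q_{83}=287$ and $Q_{397}=132$, for every $n\in\mathbb Z$, $$ \nu_p(T(n))=\begin{cases}\nu_p(n-a)+1, & \text{if } n\equiv a\pmod{Q_p} \text{ for some } a\in\{0,-1,-4,-17\},\\ 0,&\text{otherwise}.\end{cases} $$
   Context: $T:\mathbb Z\to\mathbb Z$ is the Tribonacci sequence: $T(0)=0$, $T(1)=T(2)=1$, $T(n+3)=T(n+2)+T(n+1)+T(n)$ for all $n\in\mathbb Z$. $\nu_p$ is the $p$-adic valuation on $\mathbb Q$, $\nu_p(0)=+\infty$. For a prime $p$, $\mathrm{ML}(p)$ is the statement: there exists a positive integer $Q$ such that for every $i\in\{0,1,\dots,Q-1\}$ one of the following holds: (C) there is $\kappa_i\in\mathbb Z_{\ge0}$ such that $\nu_p(T(n))=\kappa_i$ for all but finitely many $n\in\mathbb Z$ with $n\equiv i\pmod Q$; or (L) there exist $a_i\in\mathbb Z$, $\kappa_i\in\mathbb Z$, $\mu_i\in\mathbb Z_{>0}$ with $\nu_p(a_i-i)\ge\nu_p(Q)$ such that $\nu_p(T(n))=\kappa_i+\mu_i\nu_p(n-a_i)$ for all but finitely many $n\in\mathbb Z$ with $n\equiv i\pmod Q$. *)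

(* Defs.v *)
From Stdlib Require Import ZArith List.
From mathcomp Require prime.
Import ListNotations.
Open Scope Z_scope.

(* Tribonacci on Z.  Forward step on (T n, T (n+1), T (n+2)),
   backward step uses T(n-1) = T(n+2) - T(n+1) - T(n). *)
Definition trib_step (t : Z * Z * Z) : Z * Z * Z :=
  let '(a, b, c) := t in (b, c, a + b + c).
Definition trib_back (t : Z * Z * Z) : Z * Z * Z :=
  let '(a, b, c) := t in (c - b - a, a, b).
Definition first3 (t : Z * Z * Z) : Z := let '(a, _, _) := t in a.

Definition T (n : Z) : Z :=
  match n with
  | Z0 => 0
  | Zpos k => first3 (Nat.iter (Pos.to_nat k) trib_step (0, 1, 1))
  | Zneg k => first3 (Nat.iter (Pos.to_nat k) trib_back (0, 1, 1))
  end.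

(* p-adic valuation of an integer; [None] stands for +infinity (value at 0). *)
Definition vp (p : nat) (z : Z) : option nat :=
  if Z.eqb z 0 then None else Some (prime.logn p (Z.abs_nat z)).

(* "P n holds for all but finitely many n in Z with n = i (mod Q)" *)
Definition eventually_in_class (Q i : Z) (P : Z -> Prop) : Prop :=
  exists N : Z, forall n : Z, n mod Q = i mod Q -> N <= Z.abs n -> P n.

Definition ext_affine (kappa mu : Z) (v : option nat) : option Z :=
  match v with None => None | Some k => Some (kappa + mu * Z.of_nat k) end.

Definition ext_ge (v : option nat) (m : nat) : Prop :=
  match v with None => True | Some k => (m <= k)%nat end.

Definition ML (p : nat) : Prop :=
  exists Q : Z, 0 < Q /\
    forall i : Z, 0 <= i < Q ->
      (exists kappa : nat,
          eventually_in_class Q i (fun n => vp p (T n) = Some kappa))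
      \/
      (exists (a kappa mu : Z), 0 < mu /\
          ext_ge (vp p (a - i)) (prime.logn p (Z.to_nat Q)) /\
          eventually_in_class Q i
            (fun n => option_map Z.of_nat (vp p (T n)) = ext_affine kappa mu (vp p (n - a)))).

(* Main.v *)
(* If [ML p] holds, every simple [p]-adic zero of [T] along a class [n = n0 mod N] must be an
   integer [a]: the valuation of [T n] is unbounded near it, so the class modulo [Q] it meets
   is of type (L), and [n - a] tends to 0 there.  In terms of the roots [a_i] of
   [x^3 - x^2 - x - 1] and [T n = sum c_i a_i^n], this gives, with [x_i = c_i a_i^a], a relation
   [w1 x1 + w2 x2 + w3 x3 = 0] where the [w_i] are roots of unity: the limits of the
   [a_i^(n - a)].  Complex conjugation inverts the [w_i] and, [a1] being real, swaps [x2] and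
   [x3]; hence [w2 w3 = w1^2].  The same argument after an automorphism sending [a1] to [a2]
   shows that [w2 / w1] is a cube root of unity [z], and [x1 + z x2 + z^2 x3 = 0].  For [z <> 1]
   this annihilates an integral quadratic form in [T a], [T (a + 1)], [T (a + 2)] that never
   vanishes modulo 7; so [T a = 0], whence [a] is one of 0, -1, -4, -17 by the valuation
   formula for 83.  It remains to exhibit, for each [p], a simple [p]-adic zero which is not
   congruent modulo [p] to any of these. *)

Require Import Defs.
From Stdlib Require Import ZArith List Znumtheory Zpow_facts Lia.
From HB Require Import structures.
From mathcomp Require prime all_boot all_order all_algebra all_field ring zify.
Import ListNotations.
Open Scope Z_scope.

(** * Integral twisted zeros *)

Module TwistedZero.
Import all_boot all_order all_algebra all_field ring zify.
Set Implicit Arguments.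
Unset Strict Implicit.
Unset Printing Implicit Defensive.
Import Order.TTheory GRing.Theory Num.Theory.
Local Open Scope ring_scope.

(** * Congruences between algebraic integers and relations with roots of unity *)

Lemma eqAmodX e x y k : x \in Aint -> y \in Aint ->
  (x == y %[mod e])%A -> (x ^+ k == y ^+ k %[mod e])%A.
Proof.
move=> Ax Ay xy; elim: k => [|k IHk]; first exact: eqAmod_refl.
by rewrite !exprS; apply: eqAmodM => //; rewrite rpredX.
Qed.

Lemma eqAmod_prod e (I : finType) (F G : I -> algC) :
    (forall i, F i \in Aint) -> (forall i, G i \in Aint) ->
    (forall i, F i == G i %[mod e])%A ->
  (\prod_i F i == \prod_i G i %[mod e])%A.
Proof.
move=> AF AG FG.
suff: (\prod_i F i \in Aint) && (\prod_i F i == \prod_i G i %[mod e])%A by case/andP.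
apply: (big_rec2 (fun x y => (x \in Aint) && (x == y %[mod e])%A)).
  by rewrite rpred1 eqAmod_refl.
move=> i x y _ /andP[Ax xy]; rewrite rpredM //=.
rewrite ![_ * x]mulrC ![_ * y]mulrC eqAmodM //; exact: FG.
Qed.

(** A nonzero algebraic integer divides the constant term of its minimal polynomial, a nonzero
    integer, which only finitely many powers of [p] divide. *)
Lemma dvdA_exp_eq0 (p : nat) (y : algC) : (1 < p)%N ->
  (forall m : nat, (y == 0 %[mod (p ^ m)%N])%A) -> y = 0.
Proof.
move=> p_gt1 Hy; apply/eqP; apply: contraT => y_neq0.
(* Congruence modulo [p ^ 0] already says that [y] is an algebraic integer. *)
have Ay : y \in Aint.
  by move: (Hy 0%N); rewrite eqAmod0 [(_ %| _)%A]unfold_in expn0 pnatr_eq0 divr1.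
have y_root := root_minCpoly y.
have := minCpolyP y; case=> q [Dq mon_q] min_q.
have c_int i : (minCpoly y)`_i \in Num.int by apply/polyOverP.
(* Otherwise the cofactor of [X] would be a smaller polynomial vanishing at [y]. *)
have c0_neq0 : (minCpoly y)`_0 != 0.
  apply/negP => /eqP c0.
  have rX : root q 0.
    rewrite -(fmorph_root (ratr : rat -> algC)) -Dq rmorph0.
    by rewrite rootE horner_coef0 c0.
  have [q1 Dq1] := factor_theorem _ _ rX.
  have : root (map_poly ratr q1) y.
    have := y_root; rewrite Dq Dq1 rmorphM rootM /= => /orP[//|].
    by rewrite subr0 map_polyX /root hornerX (negPf y_neq0).
  rewrite min_q => /dvdp_leq.
  have q1_neq0 : q1 != 0.
    by apply: contra_eq_neq Dq1 => ->; rewrite mul0r monic_neq0.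
  move=> /(_ q1_neq0); rewrite Dq1 size_Mmonic ?monicXsubC // size_XsubC.
  by rewrite addn2 /= ltnn.
have dvd_c0 m : (p ^ m %| `|Num.floor (minCpoly y)`_0|)%N.
  have /floorK Dc := c_int 0%N.
  have : ((minCpoly y)`_0 == 0 %[mod (p ^ m)%N])%A.
    have : (minCpoly y).[y] == 0 by [].
    rewrite -[minCpoly y in X in X -> _](@coefK _) poly_def.
    rewrite horner_sum.
    have : (0 < size (minCpoly y))%N by apply: ltn_trans (size_minCpoly y).
    case: (size (minCpoly y)) => // n _.
    rewrite big_ord_recl expr0 hornerZ hornerC mulr1 addr_eq0 => /eqP->.
    rewrite -oppr0 eqAmodN opprK oppr0.
    rewrite eqAmod0; apply: rpred_sum => i _; rewrite -eqAmod0.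
    rewrite hornerZ hornerXn exprSr mulrA -[X in (_ == X %[mod _])%A](mulr0
      ((minCpoly y)`_(lift ord0 i) * y ^+ i)).
    by apply: eqAmodMl; rewrite ?rpredM ?rpredX // Aint_Cint.
  rewrite -Dc eqAmod0_rat ?rpred_nat ?rpred_int // ?Crat_int //.
  by rewrite dvdC_int ?rpred_int // floorK ?rpred_int.
have c0f : (0 < `|Num.floor (minCpoly y)`_0|)%N.
  rewrite absz_gt0; apply: contraNneq c0_neq0 => c0.
  by have /floorK <- := c_int 0%N; rewrite c0.
have := dvdn_leq c0f (dvd_c0 `|Num.floor (minCpoly y)`_0|%N).
by rewrite leqNgt ltn_expl.
Qed.

(** The factorization of [X^n - 1], evaluated at [y / x] and made homogeneous. *)
Lemma prod_sub_unity (n : nat) (z x y : algC) : n.-primitive_root z ->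
  \prod_(i < n) (y - z ^+ i * x) = y ^+ n - x ^+ n.
Proof.
move=> prim_z; have n_gt0 := prim_order_gt0 prim_z.
have [->|x_neq0] := eqVneq x 0.
  rewrite expr0n gtn_eqF // subr0.
  rewrite (eq_bigr (fun=> y)) => [|i _]; last by rewrite mulr0 subr0.
  by rewrite prodr_const card_ord.
transitivity (x ^+ n * ('X^n - 1).[y / x]).
  have -> : x ^+ n = \prod_(i < n) x by rewrite prodr_const card_ord.
  rewrite -(factor_Xn_sub_1 prim_z) big_mkord horner_prod -big_split; apply: eq_bigr => i _ /=.
  by rewrite hornerXsubC mulrBr mulrCA divff // mulr1 mulrC.
by rewrite !hornerE mulrBr mulr1 -exprMn mulrCA divff ?mulr1.
Qed.

(** Modulo [e] the product depends only on the [N]-th powers of the [x_i], so each [x_i] may be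
    replaced by [w_i * x_i]; the factor with [i = j = k = 0] then becomes the given sum. *)
Lemma eqAmod_sum_unity (N : nat) (z : algC) e (x1 x2 x3 w1 w2 w3 : algC) :
    N.-primitive_root z -> {in [:: x1; x2; x3; w1; w2; w3], forall x, x \in Aint} ->
    {in [:: w1; w2; w3], forall w, (w ^+ N == 1 %[mod e])%A} ->
    (w1 * x1 + w2 * x2 + w3 * x3 == 0 %[mod e])%A ->
  (\prod_(i < N) \prod_(j < N) \prod_(k < N)
     (z ^+ i * x1 + z ^+ j * x2 + z ^+ k * x3) == 0 %[mod e])%A.
Proof.
move=> prim_z Ax Hw Hs.
have N_gt0 := prim_order_gt0 prim_z.
have [Ax1 Ax2 Ax3 [Aw1 Aw2 Aw3]] : [/\ x1 \in Aint, x2 \in Aint, x3 \in Aint &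
   [/\ w1 \in Aint, w2 \in Aint & w3 \in Aint]].
  by split; last split; apply: Ax; rewrite !inE eqxx ?orbT.
have [Hw1 Hw2 Hw3] : [/\ (w1 ^+ N == 1 %[mod e])%A, (w2 ^+ N == 1 %[mod e])%A
   & (w3 ^+ N == 1 %[mod e])%A].
  by split; apply: Hw; rewrite !inE eqxx ?orbT.
have Az k : z ^+ k \in Aint by rewrite rpredX // (Aint_prim_root prim_z).
pose P x y t := \prod_(i < N) \prod_(j < N) \prod_(k < N)
     (z ^+ i * x + z ^+ j * y + z ^+ k * t).
have PC12 x y t : P x y t = P y x t.
  rewrite /P exchange_big; do 3!apply: eq_bigr => ? _.
  by rewrite [X in X + _]addrC.
have PC23 x y t : P x y t = P x t y.
  rewrite /P; apply: eq_bigr => i _; rewrite exchange_big.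
  by do 2!apply: eq_bigr => ? _; rewrite addrAC.
(* The innermost product is a difference of N-th powers, so it only depends on the
   N-th power of the last variable. *)
have step x y t w : x \in Aint -> y \in Aint -> t \in Aint -> w \in Aint ->
    (w ^+ N == 1 %[mod e])%A -> (P x y t == P x y (w * t) %[mod e])%A.
  move=> Ax' Ay' At' Aw' Hw'; apply: eqAmod_prod => [i|i|i].
  - by apply: rpred_prod => j _; apply: rpred_prod => k _; rewrite !rpredD ?rpredM.
  - by apply: rpred_prod => j _; apply: rpred_prod => k _; rewrite !rpredD ?rpredM.
  apply: eqAmod_prod => [j|j|j].
  - by apply: rpred_prod => k _; rewrite !rpredD ?rpredM.
  - by apply: rpred_prod => k _; rewrite !rpredD ?rpredM.
  have E s : \prod_(k < N) (z ^+ i * x + z ^+ j * y + z ^+ k * s) =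
      (z ^+ i * x + z ^+ j * y) ^+ N - (- s) ^+ N.
    by rewrite -(prod_sub_unity _ _ prim_z); apply: eq_bigr => k _; rewrite mulrN opprK.
  rewrite !E eqAmodDl eqAmodN opprK -mulrN exprMn -[X in (X == _ %[mod _])%A]mul1r.
  by apply: eqAmodMr; [rewrite rpredX ?rpredN | rewrite eqAmod_sym].
rewrite -/(P x1 x2 x3).
(* The symmetries bring each variable in turn into the last place, where [step] applies. *)
apply: eqAmod_trans (step _ _ _ w3 _ _ _ _ _) _ => //; rewrite PC23.
apply: eqAmod_trans (step _ _ _ w2 _ _ _ _ _) _ => //; rewrite ?rpredM //.
rewrite PC12 PC23.
apply: eqAmod_trans (step _ _ _ w1 _ _ _ _ _) _ => //; rewrite ?rpredM //.
rewrite /P.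
have prod0 (F : 'I_N -> algC) : (forall i, F i \in Aint) ->
    (F (Ordinal N_gt0) == 0 %[mod e])%A -> (\prod_i F i == 0 %[mod e])%A.
  move=> AF F0; rewrite (bigD1 (Ordinal N_gt0)) //= -[X in (_ == X %[mod _])%A](mul0r
    (\prod_(i < N | i != Ordinal N_gt0) F i)).
  by apply: eqAmodMr => //; apply: rpred_prod.
do 3![apply: (prod0) => [i|]; first by do 2?[apply: rpred_prod => ? _];
  rewrite !rpredD ?rpredM].
by rewrite /= !expr0 !mul1r addrC addrA addrAC.
Qed.

(** The [w_i] change with [m], but the product over all triples of [N]-th roots of unity does not:
    it is divisible by every [p ^ m], hence zero, and one of its factors vanishes. *)
Lemma sum_unity_eq0 (N p : nat) (x1 x2 x3 : algC) : (0 < N)%N -> (1 < p)%N ->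
    {in [:: x1; x2; x3], forall x, x \in Aint} ->
    (forall m, exists w1 w2 w3 : algC,
       [/\ {in [:: w1; w2; w3], forall w, w \in Aint /\ (w ^+ N == 1 %[mod (p ^ m)%N])%A} &
           (w1 * x1 + w2 * x2 + w3 * x3 == 0 %[mod (p ^ m)%N])%A]) ->
  exists w1 w2 w3 : algC, [/\ w1 ^+ N = 1, w2 ^+ N = 1, w3 ^+ N = 1 &
    w1 * x1 + w2 * x2 + w3 * x3 = 0].
Proof.
move=> N_gt0 p_gt1 Ax H.
have [z prim_z] := C_prim_root_exists N_gt0.
have : \prod_(i < N) \prod_(j < N) \prod_(k < N)
     (z ^+ i * x1 + z ^+ j * x2 + z ^+ k * x3) = 0.
  apply: (dvdA_exp_eq0 p_gt1) => m; have [w1 [w2 [w3 [Hw Hs]]]] := H m.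
  apply: eqAmod_sum_unity prim_z _ _ Hs.
    move=> x; rewrite -[[:: _; _; _; _; _; _]]/([:: x1; x2; x3] ++ [:: w1; w2; w3]).
    by rewrite mem_cat => /orP[/Ax//|/Hw[]].
  by move=> w /Hw[].
move/eqP; rewrite prodf_seq_eq0 => /hasP[i _ /=].
rewrite prodf_seq_eq0 => /hasP[j _ /=].
rewrite prodf_seq_eq0 => /hasP[k _ /= /eqP s0].
exists (z ^+ i), (z ^+ j), (z ^+ k).
by split=> //; rewrite exprAC (prim_expr_order prim_z) expr1n.
Qed.

Lemma normC_unity (N : nat) (w : algC) : (0 < N)%N -> w ^+ N = 1 -> w * w^* = 1.
Proof.
move=> N_gt0 wN; have : `|w| ^+ N = 1 by rewrite -normrX wN normr1.
move/eqP; rewrite pexpr_eq1 // => /eqP w1.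
by rewrite -normCK w1 expr1n.
Qed.

(* The sides of the triangle have real and conjugate directions, so it is
   isosceles and the unit factors are forced. *)
Lemma isosceles (x1 x2 x3 w1 w2 w3 : algC) :
    x1^* = x1 -> x2^* = x3 -> x3^* = x2 -> x1 != 0 ->
    w1 * w1^* = 1 -> w2 * w2^* = 1 -> w3 * w3^* = 1 ->
    w1 * x1 + w2 * x2 + w3 * x3 = 0 ->
  w2 * w3 = w1 ^+ 2.
Proof.
move=> c1 c2 c3 x1n0 u1 u2 u3 E.
have E' : w1^* * x1 + w2^* * x3 + w3^* * x2 = 0.
  by have := congr1 Num.conj E; rewrite !rmorphD !rmorphM /= c1 c2 c3 rmorph0.
have : (w2 * w3 - w1 ^+ 2) * x1 = 0.
  (* Multiplying the conjugate relation by [w1 * w2 * w3] clears the conjugates; subtracting [w1]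
     times the original relation leaves only the terms in [x1]. *)
  have -> : (w2 * w3 - w1 ^+ 2) * x1 =
    w2 * w3 * w1 * (w1^* * x1 + w2^* * x3 + w3^* * x2)
    - w1 * (w1 * x1 + w2 * x2 + w3 * x3)
    - (w1 * w1^* - 1) * w2 * w3 * x1 - (w2 * w2^* - 1) * w1 * w3 * x3
    - (w3 * w3^* - 1) * w1 * w2 * x2 by ring.
  by rewrite E E' u1 u2 u3 subrr; ring.
by move/eqP; rewrite mulf_eq0 (negPf x1n0) orbF subr_eq0 => /eqP.
Qed.

(** * The roots of the characteristic polynomial and their automorphisms *)

Definition trib_poly (R : nzRingType) : {poly R} := 'X^3 - 'X^2 - 'X - 1.

Lemma size_trib_poly (R : nzRingType) : size (trib_poly R) = 4.
Proof.
apply/eqP; rewrite eqn_leq; apply/andP; split.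
  apply/leq_sizeP => j j4.
  rewrite !(coefB, coefXn, coefX, coefC).
  by case: j j4 => [|[|[|[|j]]]] //= _; rewrite !subr0.
rewrite ltnNge; apply/negP => /leq_sizeP/(_ 3 isT) /eqP.
by rewrite !(coefB, coefXn, coefX, coefC) /= !subr0 oner_eq0.
Qed.

Lemma trib_poly_monic (R : nzRingType) : trib_poly R \is monic.
Proof.
rewrite monicE lead_coefE size_trib_poly.
by rewrite !(coefB, coefXn, coefX, coefC) /= !subr0.
Qed.

Lemma map_trib_poly (R S : nzRingType) (g : {rmorphism R -> S}) :
  map_poly g (trib_poly R) = trib_poly S.
Proof. by rewrite /trib_poly !rmorphB /= !map_polyXn map_polyX rmorph1. Qed.

Lemma horner_trib_poly (R : comNzRingType) (x : R) :
  (trib_poly R).[x] = x ^+ 3 - x ^+ 2 - x - 1.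
Proof. by rewrite /trib_poly !hornerE. Qed.

(** Vieta's relations for [x^3 - x^2 - x - 1]; any ring morphism preserves them, and symmetric
    functions of the roots are evaluated by rewriting. *)
Record trib_roots (a1 a2 a3 : algC) : Prop := TribRoots {
  tr_sum : a1 + a2 + a3 = 1;
  tr_sum2 : a1 * a2 + a2 * a3 + a1 * a3 = -1;
  tr_prod : a1 * a2 * a3 = 1 }.

Lemma trib_rootE a1 a2 a3 : trib_roots a1 a2 a3 ->
  forall x, (x ^+ 3 == x ^+ 2 + x + 1) = (x \in [:: a1; a2; a3]).
Proof.
move=> [s1 s2 s3] x; rewrite -subr_eq0.
have -> : x ^+ 3 - (x ^+ 2 + x + 1) = (x - a1) * (x - a2) * (x - a3).
  transitivity (x ^+ 3 - (a1 + a2 + a3) * x ^+ 2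
    + (a1 * a2 + a2 * a3 + a1 * a3) * x - a1 * a2 * a3); last by ring.
  by rewrite s1 s2 s3; ring.
by rewrite !mulf_eq0 !subr_eq0 !inE orbA.
Qed.

(** The discriminant of the cubic, through elementary symmetric functions. Being negative, it makes
    the roots distinct and not all real. *)
Lemma trib_disc a1 a2 a3 : trib_roots a1 a2 a3 ->
  ((a1 - a2) * (a2 - a3) * (a1 - a3)) ^+ 2 = - 44%:R.
Proof.
move=> [s1 s2 s3].
transitivity ((a1 + a2 + a3) ^+ 2 * (a1 * a2 + a2 * a3 + a1 * a3) ^+ 2
  - 4%:R * (a1 * a2 + a2 * a3 + a1 * a3) ^+ 3 - 4%:R * (a1 + a2 + a3) ^+ 3 * (a1 * a2 * a3)
  + 18%:R * (a1 + a2 + a3) * (a1 * a2 + a2 * a3 + a1 * a3) * (a1 * a2 * a3)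
  - 27%:R * (a1 * a2 * a3) ^+ 2); first by ring.
by rewrite s1 s2 s3; ring.
Qed.

Lemma trib_rootsC a1 a2 a3 : trib_roots a1 a2 a3 -> trib_roots a2 a1 a3.
Proof. by case=> s1 s2 s3; split; [rewrite -s1 | rewrite -s2 | rewrite -s3]; ring. Qed.

Lemma trib_rootsR a1 a2 a3 : trib_roots a1 a2 a3 -> trib_roots a2 a3 a1.
Proof. by case=> s1 s2 s3; split; [rewrite -s1 | rewrite -s2 | rewrite -s3]; ring. Qed.

Lemma trib_neq a1 a2 a3 : trib_roots a1 a2 a3 -> a1 != a2.
Proof.
move=> tr; have := trib_disc tr; apply: contra_eq_neq => ->.
by rewrite subrr !mul0r expr0n /= eq_sym oppr_eq0 pnatr_eq0.
Qed.

Lemma trib_roots_rmorph (nu : {rmorphism algC -> algC}) a1 a2 a3 :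
  trib_roots a1 a2 a3 -> trib_roots (nu a1) (nu a2) (nu a3).
Proof.
case=> s1 s2 s3; split; rewrite -!(rmorphM, rmorphD) /= ?s1 ?s2 ?s3.
all: by rewrite ?rmorphN rmorph1.
Qed.

Lemma trib_rootsE a1 a2 a3 b1 b2 b3 : trib_roots a1 a2 a3 -> trib_roots b1 b2 b3 ->
  b1 \in [:: a1; a2; a3].
Proof.
by move=> ta tb; rewrite -(trib_rootE ta) (trib_rootE tb) inE eqxx.
Qed.

Lemma trib_roots_exist : exists a1 a2 a3, trib_roots a1 a2 a3.
Proof.
have [r] := closed_field_poly_normal (trib_poly algC).
rewrite (monicP (trib_poly_monic _)) scale1r => Dr.
have : size r = 3 by have := size_trib_poly algC; rewrite Dr size_prod_XsubC => -[].
case: r Dr => [|a1 [|a2 [|a3 []]]] // Dr _; exists a1, a2, a3.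
have fx x : x ^+ 3 - x ^+ 2 - x - 1 = (x - a1) * (x - a2) * (x - a3).
  rewrite -horner_trib_poly Dr !big_cons big_nil mulr1 !hornerM !hornerXsubC.
  by rewrite mulrA.
(* The values at 0, 1 and -1 determine the three symmetric functions. *)
have e0 := fx 0; have e1 := fx 1; have em := fx (-1).
have s3 : a1 * a2 * a3 = 1.
  by transitivity (- ((0 - a1) * (0 - a2) * (0 - a3))); [ring | rewrite -e0; ring].
have two : 2%:R != 0 :> algC by rewrite pnatr_eq0.
split=> //.
- apply: (mulfI two); apply/eqP; rewrite -subr_eq0; apply/eqP.
  transitivity (- ((1 - a1) * (1 - a2) * (1 - a3)) - (-1 - a1) * (-1 - a2) * (-1 - a3)
    - 2%:R * (a1 * a2 * a3) - 2%:R); last by rewrite -e1 -em s3; ring.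
  by ring.
apply: (mulfI two); apply/eqP; rewrite -subr_eq0; apply/eqP.
transitivity ((1 - a1) * (1 - a2) * (1 - a3) - (-1 - a1) * (-1 - a2) * (-1 - a3)
    ); last by rewrite -e1 -em; ring.
by ring.
Qed.

(** Conjugation permutes the roots, and moves one of them since the square of a real number is not
    -44; as it preserves the sum of the roots, it fixes the third. *)
Lemma trib_roots_conj : exists a1 a2 a3,
  [/\ trib_roots a1 a2 a3, a1^* = a1, a2^* = a3 & a3^* = a2].
Proof.
have conj_pair b1 b2 b3 : trib_roots b1 b2 b3 -> b1^* = b2 ->
    exists a1 a2 a3, [/\ trib_roots a1 a2 a3, a1^* = a1, a2^* = a3 & a3^* = a2].
  move=> tb c1; have c2 : b2^* = b1 by rewrite -c1 conjCK.
  exists b3, b1, b2; split=> //; first exact/trib_rootsR/trib_rootsR.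
  have [+ _ _] := trib_roots_rmorph Num.conj tb.
  rewrite /= c1 c2 -(tr_sum tb) [b2 + b1]addrC; exact: addrI.
have nonreal b1 b2 b3 : trib_roots b1 b2 b3 -> b1^* != b1 ->
    exists a1 a2 a3, [/\ trib_roots a1 a2 a3, a1^* = a1, a2^* = a3 & a3^* = a2].
  move=> tb b1nr; have := trib_rootsE tb (trib_roots_rmorph Num.conj tb).
  rewrite !inE (negPf b1nr) /= => /orP[/eqP|/eqP]; first exact: conj_pair tb.
  by apply: (@conj_pair b1 b3 b2); apply/trib_rootsC/trib_rootsR/trib_rootsR.
have [b1 [b2 [b3 tb]]] := trib_roots_exist.
have [r1|] := eqVneq b1^* b1; last exact: nonreal tb.
have [r2|] := eqVneq b2^* b2; last exact/nonreal/trib_rootsC/tb.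
have [r3|] := eqVneq b3^* b3; last exact/nonreal/trib_rootsR/trib_rootsR/tb.
have real_b (b : algC) : b^* = b -> b \is Num.real by move=> rb; rewrite CrealE rb.
have := trib_disc tb; set d := _ * _ * _ => dE.
have : 0 <= d ^+ 2 by rewrite real_exprn_even_ge0 // !rpredM // rpredB // real_b.
by rewrite dE oppr_ge0 lern0.
Qed.

(** For a cubic it suffices to exclude rational roots; such a root would be an algebraic integer,
    hence an integer [m] with [m^3 - m^2 - m = 1]. *)
Lemma trib_poly_irreducible : irreducible_poly (trib_poly rat).
Proof.
apply: cubic_irreducible; first by rewrite size_trib_poly.
move=> r; apply/negP => r_root.
have c_root : root (trib_poly algC) (ratr r).
  by rewrite -(map_trib_poly (ratr : {rmorphism rat -> algC})) fmorph_root.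
have : (ratr r : algC) \in Num.int.
  apply: Cint_rat_Aint; first exact: Crat_rat.
  apply: root_monic_Aint c_root (trib_poly_monic _) _.
  by apply/polyOverP => i; rewrite !(coefB, coefXn, coefX, coef1) !rpredB ?rpred_nat.
case/intrP=> m mE; move: c_root; rewrite mE rootE horner_trib_poly.
rewrite -!rmorphXn -[1]/(1%:~R) -!rmorphB /= intr_eq0 !exprS expr0 !mulr1 => /eqP {}mE.
have : (m <= -1 \/ m = 0 \/ m = 1 \/ 2 <= m)%R by lia.
case=> [m1|[m0|[m1|m2]]]; nia.
Qed.

(** By irreducibility [a1] and [a2] are conjugate: the embedding of the field of [a1] that sends it
    to [a2] extends to a splitting field and then to [algC]. *)
Lemma trib_rmorph a1 a2 a3 : trib_roots a1 a2 a3 ->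
  exists nu : {rmorphism algC -> algC}, nu a1 = a2.
Proof.
move=> ta; have [Qs [QsC [zs]]] := num_field_exists [:: a1; a2; a3].
case: zs => [|z1 [|z2 [|z3 [|//]]]] //= [Dz1 Dz2 Dz3] genQs.
set zs := [:: z1; z2; z3] in genQs.
have fE : trib_poly Qs = \prod_(z <- zs) ('X - z%:P).
  apply: (map_poly_inj QsC); rewrite map_trib_poly rmorph_prod /=.
  under eq_bigr do rewrite map_polyXsubC.
  rewrite -(big_map QsC predT (fun a => 'X - a%:P)) /= Dz1 Dz2 Dz3.
  have [s1 s2 s3] := ta; rewrite !big_cons big_nil mulr1.
  transitivity ('X^3 - (a1 + a2 + a3)%:P * 'X^2
    + (a1 * a2 + a2 * a3 + a1 * a3)%:P * 'X - (a1 * a2 * a3)%:P).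
    by rewrite s1 s2 s3 polyCN /trib_poly; ring.
  by rewrite !polyCD !polyCM; ring.
have f1 : trib_poly Qs \is a polyOver 1%VS.
  by rewrite /trib_poly !rpredB ?rpredX ?rpred1 // ?polyOverX.
have splitf : splittingFieldFor 1 (trib_poly Qs) {:Qs} by exists zs; rewrite // fE eqpxx.
(* The minimal polynomial of [z1] divides the irreducible [trib_poly], so it is associate to it and
   vanishes at [z2]. *)
have root12 : root (map_poly \1%VF (minPoly 1 z1)) z2.
  have /polyOver1P[q qE] := minPolyOver 1 z1.
  have Qq : q %= trib_poly rat.
    apply: (trib_poly_irreducible.2).
      by rewrite -(size_map_poly (in_alg Qs)) -qE size_minPoly eqSS -lt0n.
    rewrite -(dvdp_map (in_alg Qs)) -qE map_trib_poly minPoly_dvdp // fE.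
    by rewrite root_prod_XsubC mem_head.
  rewrite lfun1_poly qE; move: Qq; rewrite -(eqp_map (in_alg Qs)) => /eqp_root ->.
  by rewrite map_trib_poly fE root_prod_XsubC !inE eqxx orbT.
have hom12 := kHomExtendP (sub1v _) (kHom1 1 _) root12.
have splitf1 := splittingFieldForS (sub1v <<1; z1>>) (subvf _) splitf.
have [g homg gE] := kHom_extends (sub1v <<1; z1>>) hom12 f1 splitf1.
pose gM := GRing.isMonoidMorphism.Build _ _ g (kHom_monoid_morphism homg).
pose gRM : {rmorphism _ -> _} := HB.pack (fun_of_lfun g) gM.
have [nu Dnu] := extend_algC_subfield_aut QsC gRM.
exists nu; rewrite -Dz1 -Dnu /= -gE ?memv_adjoin //.
by rewrite (kHomExtend_val (kHom1 1 1)).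
Qed.

(** * Binet's formula and symmetric functions of its coefficients *)

(* 22 times the coefficient of the root [a] in the solution of the Tribonacci
   recurrence with initial values [t0, t1, t2]; here [22 = 44 / 2] clears the
   denominator [f'(a)], of norm 44. *)
Definition trib_coef (t0 t1 t2 : int) (a : algC) : algC :=
  t0%:~R * (8%:R - 5%:R * a + a ^+ 2)
  + t1%:~R * (- 5%:R - 12%:R * a + 9%:R * a ^+ 2)
  + t2%:~R * (1 + 9%:R * a - 4%:R * a ^+ 2).

Section TribCoef.

Variables (a1 a2 a3 : algC) (t0 t1 t2 : int).
Hypothesis ta : trib_roots a1 a2 a3.

Let A : algC := 8%:R * t0%:~R - 5%:R * t1%:~R + t2%:~R.
Let B : algC := - 5%:R * t0%:~R - 12%:R * t1%:~R + 9%:R * t2%:~R.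
Let C : algC := t0%:~R + 9%:R * t1%:~R - 4%:R * t2%:~R.
Let X := trib_coef t0 t1 t2.

Let XE a : X a = A + B * a + C * a ^+ 2.
Proof. by rewrite /X /trib_coef /A /B /C; ring. Qed.

Lemma trib_coef_rmorph (nu : {rmorphism algC -> algC}) a : nu (X a) = X (nu a).
Proof.
by rewrite /X /trib_coef !(rmorphD, rmorphB, rmorphM, rmorphN, rmorphXn, rmorph_int,
  rmorph_nat, rmorph1).
Qed.

(** The norm of [X a1], expanded through the elementary symmetric functions of the roots; when it is
    nonzero, so is [X a1]. *)
Lemma trib_coef_prod : X a1 * X a2 * X a3 =
  242%:R * (t0 ^+ 3 + t1 ^+ 3 *+ 2 + t2 ^+ 3 + t0 * t1 ^+ 2 *+ 2 + t0 ^+ 2 * t1 *+ 2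
    - t0 * t2 ^+ 2 + t0 ^+ 2 * t2 - t1 * t2 ^+ 2 *+ 2 - t0 * t1 * t2 *+ 2)%:~R.
Proof.
rewrite !XE; have [s1 s2 s3] := ta.
pose e1 := a1 + a2 + a3; pose e2 := a1 * a2 + a2 * a3 + a1 * a3; pose e3 := a1 * a2 * a3.
transitivity (A ^+ 3 + B ^+ 3 * e3 + C ^+ 3 * e3 ^+ 2 + A ^+ 2 * B * e1
  + A ^+ 2 * C * (e1 ^+ 2 - 2%:R * e2) + A * B ^+ 2 * e2 + B ^+ 2 * C * e1 * e3
  + A * C ^+ 2 * (e2 ^+ 2 - 2%:R * e1 * e3) + B * C ^+ 2 * e2 * e3
  + A * B * C * (e1 * e2 - 3%:R * e3)); first by rewrite /e1 /e2 /e3; ring.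
by rewrite /e1 /e2 /e3 s1 s2 s3 /A /B /C; ring.
Qed.

(** The left side is the product of [X a1 + z X a2 + z^2 X a3] over the two primitive cube roots of
    unity [z]. *)
Lemma trib_coef_sumsq :
  X a1 ^+ 2 + X a2 ^+ 2 + X a3 ^+ 2 - X a1 * X a2 - X a2 * X a3 - X a1 * X a3 =
  22%:R * (t0 ^+ 2 - t1 ^+ 2 *+ 18 - t0 * t1 *+ 15 - t2 ^+ 2 *+ 6 + t0 * t2 *+ 3
    + t1 * t2 *+ 27)%:~R.
Proof.
rewrite !XE; have [s1 s2 s3] := ta.
pose e1 := a1 + a2 + a3; pose e2 := a1 * a2 + a2 * a3 + a1 * a3; pose e3 := a1 * a2 * a3.
transitivity (B ^+ 2 * (e1 ^+ 2 - 3%:R * e2)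
  + B * C * (2%:R * e1 ^+ 3 - 7%:R * e1 * e2 + 9%:R * e3)
  + C ^+ 2 * ((e1 ^+ 2 - 2%:R * e2) ^+ 2 - 3%:R * (e2 ^+ 2 - 2%:R * e1 * e3))).
  by rewrite /e1 /e2 /e3; ring.
by rewrite /e1 /e2 /e3 s1 s2 s3 /A /B /C; ring.
Qed.

Lemma trib_root_rec a k : a \in [:: a1; a2; a3] ->
  a ^+ k.+3 = a ^+ k.+2 + a ^+ k.+1 + a ^+ k.
Proof.
rewrite -(trib_rootE ta) => /eqP aE.
by rewrite -[k.+3]addn3 exprD aE !exprS; ring.
Qed.

(** Binet's formula scaled by 22: both sides satisfy the recurrence, so comparison at 0, 1 and 2 is
    enough. *)
Lemma trib_coef_sum (u : nat -> int) k :
    u 0%N = t0 -> u 1%N = t1 -> u 2%N = t2 ->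
    (forall k, u k.+3 = u k.+2 + u k.+1 + u k) ->
  a1 ^+ k * X a1 + a2 ^+ k * X a2 + a3 ^+ k * X a3 = 22%:R * (u k)%:~R.
Proof.
move=> u0 u1 u2 urec; have [s1 s2 s3] := ta.
pose e1 := a1 + a2 + a3; pose e2 := a1 * a2 + a2 * a3 + a1 * a3; pose e3 := a1 * a2 * a3.
pose S k := a1 ^+ k * X a1 + a2 ^+ k * X a2 + a3 ^+ k * X a3.
have Srec j : S j.+3 = S j.+2 + S j.+1 + S j.
  by rewrite /S !trib_root_rec ?inE ?eqxx ?orbT //; ring.
(* Newton's identities for the power sums of the roots. *)
pose p1 := e1; pose p2 := e1 ^+ 2 - 2%:R * e2.
pose p3 := e1 ^+ 3 - 3%:R * e1 * e2 + 3%:R * e3.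
pose p4 := e1 * p3 - e2 * p2 + e3 * p1.
have S0 : S 0%N = 22%:R * (u 0%N)%:~R.
  transitivity (3%:R * A + B * p1 + C * p2).
    by rewrite /S !XE /p1 /p2 /e1 /e2; ring.
  by rewrite /p1 /p2 /e1 /e2 s1 s2 u0 /A /B /C; ring.
have S1 : S 1%N = 22%:R * (u 1%N)%:~R.
  transitivity (A * p1 + B * p2 + C * p3).
    by rewrite /S !XE /p1 /p2 /p3 /e1 /e2 /e3; ring.
  by rewrite /p1 /p2 /p3 /e1 /e2 /e3 s1 s2 s3 u1 /A /B /C; ring.
have S2 : S 2%N = 22%:R * (u 2%N)%:~R.
  transitivity (A * p2 + B * p3 + C * p4).
    by rewrite /S !XE /p4 /p1 /p2 /p3 /e1 /e2 /e3; ring.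
  by rewrite /p4 /p1 /p2 /p3 /e1 /e2 /e3 s1 s2 s3 u2 /A /B /C; ring.
rewrite -/(S k); suff [] : [/\ S k = 22%:R * (u k)%:~R, S k.+1 = 22%:R * (u k.+1)%:~R &
  S k.+2 = 22%:R * (u k.+2)%:~R] by [].
elim: k => [//|k [Sk Sk1 Sk2]]; split=> //.
by rewrite Srec urec Sk Sk1 Sk2 !rmorphD; ring.
Qed.

(** Coordinates of [a ^ k] in [1, a, a^2]; congruences for [tau] thus become congruences for powers
    of the roots. *)
Lemma trib_root_exp (tau : nat -> int) a k : a \in [:: a1; a2; a3] ->
    tau 0%N = 1 -> tau 1%N = 0 -> tau 2%N = 0 ->
    (forall k, tau k.+3 = tau k.+2 + tau k.+1 + tau k) ->
  a ^+ k = (tau k)%:~R + (tau k.+2 - tau k.+1)%:~R * a + (tau k.+1)%:~R * a ^+ 2.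
Proof.
move=> ra tau0 tau1 tau2 taurec; elim: k => [|k IHk].
  by rewrite tau0 tau1 tau2; ring.
have aE : a ^+ 3 = a ^+ 2 + a + 1 by rewrite trib_root_rec // expr1.
transitivity ((tau k)%:~R * a + (tau k.+2 - tau k.+1)%:~R * a ^+ 2 + (tau k.+1)%:~R * a ^+ 3).
  by rewrite exprS IHk; ring.
by rewrite aE taurec; ring.
Qed.

Lemma trib_root_Aint a : a \in [:: a1; a2; a3] -> a \in Aint.
Proof.
rewrite -(trib_rootE ta) => ra.
apply: (root_monic_Aint _ (trib_poly_monic _)).
  by rewrite rootE horner_trib_poly (eqP ra); apply/eqP; ring.
by apply/polyOverP => i; rewrite !(coefB, coefXn, coefX, coef1) !rpredB ?rpred_nat.
Qed.

End TribCoef.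

(** The relations make every [w_i^3] equal to [w1 w2 w3]. With [y_i = w_i x_i] of sum zero,
    [y1^3 + y2^3 + y3^3 = 3 y1 y2 y3]; cancelling the common cube gives the same identity for the
    [x_i], which factors as stated. *)
Lemma sum_cubes_eq0 (x1 x2 x3 w1 w2 w3 : algC) : w1 != 0 -> w2 != 0 -> w3 != 0 ->
    w1 * x1 + w2 * x2 + w3 * x3 = 0 ->
    w2 * w3 = w1 ^+ 2 -> w1 * w3 = w2 ^+ 2 \/ w1 * w2 = w3 ^+ 2 ->
  (x1 + x2 + x3) *
    (x1 ^+ 2 + x2 ^+ 2 + x3 ^+ 2 - x1 * x2 - x2 * x3 - x1 * x3) = 0.
Proof.
move=> w1n0 w2n0 w3n0 E e1 e23.
(* Two of the three relations imply the third. *)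
have [e2 e3] : w1 * w3 = w2 ^+ 2 /\ w1 * w2 = w3 ^+ 2.
  case: e23 => [e2|e3]; split=> //.
    apply: (mulfI w1n0); apply: (mulfI w2n0).
    transitivity ((w2 * w1 * w2) * w1); first by ring.
    rewrite -mulrA -mulrA -[w2 * w1]mulrC.
    have -> : w2 * (w1 * w3 ^+ 2) = (w2 * w3) * (w1 * w3) by ring.
    by rewrite e1 e2; ring.
  apply: (mulfI w1n0); apply: (mulfI w3n0).
  transitivity ((w3 * w1) * (w1 * w3)); first by ring.
  have -> : w3 * (w1 * w2 ^+ 2) = (w2 * w3) * (w1 * w2) by ring.
  by rewrite e1 e3; ring.
have d : w1 * w2 * w3 = w1 ^+ 3 by rewrite -mulrA e1; ring.
have d2 : w2 ^+ 3 = w1 * w2 * w3 by rewrite exprS -e2; ring.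
have d3 : w3 ^+ 3 = w1 * w2 * w3 by rewrite exprS -e3; ring.
apply: (mulfI (expf_neq0 3 w1n0)); rewrite mulr0.
transitivity ((w1 * x1) ^+ 3 + w1 ^+ 3 * x2 ^+ 3 + w1 ^+ 3 * x3 ^+ 3
  - 3%:R * w1 ^+ 3 * (x1 * x2 * x3)); first by ring.
rewrite -{1 2}d -d2; have -> : w2 ^+ 3 * x3 ^+ 3 = w3 ^+ 3 * x3 ^+ 3 by rewrite d2 d3.
rewrite -d.
transitivity ((w1 * x1 + w2 * x2 + w3 * x3) * ((w1 * x1) ^+ 2 + (w2 * x2) ^+ 2 + (w3 * x3) ^+ 2
  - (w1 * x1) * (w2 * x2) - (w2 * x2) * (w3 * x3) - (w1 * x1) * (w3 * x3))); first by ring.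
by rewrite E mul0r.
Qed.

Lemma eqAmod_int (e : nat) (n : int) : (e %| `|n|)%N -> (n%:~R == 0 %[mod e])%A.
Proof.
case/dvdnP=> q nE; rewrite [n]intEsign nE PoszM !rmorphM /=.
by rewrite mulrA eqAmodMl0 // rpredM ?Aint_int.
Qed.

Lemma eqAmod0P (e : nat) (x : algC) : (0 < e)%N ->
  reflect (exists2 b, b \in Aint & x = e%:R * b) (x == 0 %[mod e])%A.
Proof.
move=> e_gt0; have en0 : e%:R != 0 :> algC by rewrite pnatr_eq0 -lt0n.
apply: (iffP idP) => [|[b Ab ->]]; last exact: eqAmodMr0.
rewrite eqAmod0 [(_ %| _)%A]unfold_in (negPf en0) => Axe.
by exists (x / e%:R) => //; rewrite mulrC divfK.
Qed.

(** Each [p]-th power gains a factor [p]: in the factorization of [Y^p - 1] by [Y - 1], the cofactor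
    is a sum of [p] terms congruent to 1 modulo [p]. *)
Lemma eqAmod_exp_expn (p m : nat) (y : algC) : (0 < p)%N -> y \in Aint ->
  (y == 1 %[mod p])%A -> (y ^+ (p ^ m) == 1 %[mod (p ^ m)%N])%A.
Proof.
move=> p_gt0 Ay y1.
suff : (y ^+ (p ^ m) - 1 == 0 %[mod (p ^ m.+1)%N])%A.
  case/eqAmod0P=> [|b Ab yE]; first by rewrite expn_gt0 p_gt0.
  rewrite /eqAmod -eqAmod0; apply/eqAmod0P; first by rewrite expn_gt0 p_gt0.
  by exists (p%:R * b); rewrite ?rpredM ?rpred_nat // mulrA -natrM -expnSr.
elim: m => [|m IHm]; first by rewrite expr1 eqAmod0.
set Y := y ^+ (p ^ m) in IHm; have AY : Y \in Aint by rewrite rpredX.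
have pm_gt0 k : (0 < p ^ k)%N by rewrite expn_gt0 p_gt0.
have Y1 : (Y == 1 %[mod p])%A by rewrite -(expr1n _ (p ^ m)) eqAmodX ?rpred1.
have sY : (\sum_(i < p) Y ^+ i == 0 %[mod p])%A.
  have -> : \sum_(i < p) Y ^+ i = \sum_(i < p) (Y ^+ i - 1) + p%:R.
    by rewrite sumrB sumr_const card_ord subrK.
  rewrite -[X in (_ == X %[mod _])%A]addr0 eqAmodD ?eqAmodm0 //.
  rewrite eqAmod0 rpred_sum // => i _; rewrite -[_ \in _]/(Y ^+ i == 1 %[mod p])%A.
  by rewrite -(expr1n _ i) eqAmodX ?rpred1.
rewrite (expnSr p m) exprM -/Y subrX1.
have [b Ab ->] := eqAmod0P _ (pm_gt0 m.+1) IHm.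
have [c Ac ->] := eqAmod0P _ p_gt0 sY.
apply/eqAmod0P => //; exists (b * c); first by rewrite rpredM.
by rewrite (expnSr p m.+1) natrM; ring.
Qed.

(** The powers [a_i ^ k] serve as the [w_i] of [sum_unity_eq0]: the weighted sum is [22 * u k], and
    since [p ^ m] divides [k], the power [(a_i ^ N) ^ k] is 1 modulo [p ^ m]. *)
Lemma trib_coef_unity_sum (u tau : nat -> int) (p N : nat) a1 a2 a3 :
    trib_roots a1 a2 a3 -> (1 < p)%N -> (0 < N)%N ->
    (forall k, u k.+3 = u k.+2 + u k.+1 + u k) ->
    tau 0%N = 1 -> tau 1%N = 0 -> tau 2%N = 0 ->
    (forall k, tau k.+3 = tau k.+2 + tau k.+1 + tau k) ->
    (p %| `|tau N - 1|)%N -> (p %| `|tau N.+1|)%N -> (p %| `|tau N.+2|)%N ->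
    (forall m, exists2 k, (p ^ m %| k)%N & (p ^ m %| `|u k|)%N) ->
  let X := trib_coef (u 0%N) (u 1%N) (u 2%N) in
  exists w1 w2 w3 : algC, [/\ w1 ^+ N = 1, w2 ^+ N = 1, w3 ^+ N = 1 &
    w1 * X a1 + w2 * X a2 + w3 * X a3 = 0].
Proof.
move=> ta p_gt1 N_gt0 urec tau0 tau1 tau2 taurec N0 N1 N2 Hu X.
have Aa := trib_root_Aint ta.
have aN a : a \in [:: a1; a2; a3] -> (a ^+ N == 1 %[mod p])%A.
  move=> ra; rewrite (trib_root_exp ta N ra tau0 tau1 tau2 taurec).
  have zero n (b : algC) : b \in Aint -> (p %| `|n|)%N -> (n%:~R * b == 0 %[mod p])%A.
    move=> Ab /eqAmod_int pn; rewrite -[X in (_ == X %[mod _])%A](mul0r b).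
    exact: eqAmodMr.
  rewrite -[X in (_ == X %[mod _])%A]addr0 -[X in (_ == X + _ %[mod _])%A]addr0.
  rewrite !eqAmodD ?zero ?rpredX ?Aa //.
    have -> : (tau N)%:~R = (tau N - 1)%:~R + 1 :> algC by rewrite rmorphB /= subrK.
    by rewrite -[X in (_ == X %[mod _])%A]add0r eqAmodDr eqAmod_int.
  by rewrite -[(p %| _)%N]/(p%:Z %| tau N.+2 - tau N.+1)%Z rpredB.
have memr : [/\ a1 \in [:: a1; a2; a3], a2 \in [:: a1; a2; a3] & a3 \in [:: a1; a2; a3]].
  by rewrite !inE !eqxx !orbT.
have [r1 r2 r3] := memr.
have AX a : a \in [:: a1; a2; a3] -> X a \in Aint.
  move=> /Aa Aa'; rewrite /X /trib_coef.
  by rewrite !(rpredD, rpredB, rpredM, rpredN, rpredX, Aint_int, rpred_nat, rpred1).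
apply: (sum_unity_eq0 N_gt0 p_gt1).
  by move=> x; rewrite !inE => /or3P[] /eqP->; apply: AX.
move=> m; have [k /dvdnP[q kE] uk] := Hu m.
exists (a1 ^+ k), (a2 ^+ k), (a3 ^+ k); split; last first.
  rewrite (trib_coef_sum ta k (erefl _) (erefl _) (erefl _) urec).
  rewrite -[X in (_ == X %[mod _])%A](mulr0 22%:R) eqAmodMl ?rpred_nat //.
  exact: eqAmod_int.
have H a : a \in [:: a1; a2; a3] ->
    a ^+ k \in Aint /\ ((a ^+ k) ^+ N == 1 %[mod (p ^ m)%N])%A.
  move=> ra; split; first by rewrite rpredX ?Aa.
  rewrite exprAC kE mulnC exprM -[X in (_ == X %[mod _])%A](expr1n _ q).
  apply: eqAmodX; [by rewrite !rpredX ?Aa | exact: rpred1 |].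
  by apply: eqAmod_exp_expn; rewrite ?rpredX ?Aa ?aN // ltnW.
by move=> w; rewrite !inE => /or3P[] /eqP->; apply: H.
Qed.

(** Of the two factors left by [sum_cubes_eq0], the sum of the [X a_i] is [22 * t0] and the other is
    22 times the quadratic form. *)
Theorem twisted_zero (u tau : nat -> int) (p N : nat) :
    (1 < p)%N -> (0 < N)%N ->
    (forall k, u k.+3 = u k.+2 + u k.+1 + u k) ->
    tau 0%N = 1 -> tau 1%N = 0 -> tau 2%N = 0 ->
    (forall k, tau k.+3 = tau k.+2 + tau k.+1 + tau k) ->
    (p %| `|tau N - 1|)%N -> (p %| `|tau N.+1|)%N -> (p %| `|tau N.+2|)%N ->
    (forall m, exists2 k, (p ^ m %| k)%N & (p ^ m %| `|u k|)%N) ->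
    let t0 := u 0%N in let t1 := u 1%N in let t2 := u 2%N in
    t0 ^+ 3 + t1 ^+ 3 *+ 2 + t2 ^+ 3 + t0 * t1 ^+ 2 *+ 2 + t0 ^+ 2 * t1 *+ 2
      - t0 * t2 ^+ 2 + t0 ^+ 2 * t2 - t1 * t2 ^+ 2 *+ 2 - t0 * t1 * t2 *+ 2 != 0 ->
  t0 = 0 \/ t0 ^+ 2 - t1 ^+ 2 *+ 18 - t0 * t1 *+ 15 - t2 ^+ 2 *+ 6 + t0 * t2 *+ 3
    + t1 * t2 *+ 27 = 0.
Proof.
move=> p_gt1 N_gt0 urec tau0 tau1 tau2 taurec N0 N1 N2 Hu t0 t1 t2 nz.
have [a1 [a2 [a3 [ta c1 c2 c3]]]] := trib_roots_conj.
have [w1 [w2 [w3 [u1 u2 u3 E]]]] :=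
  trib_coef_unity_sum ta p_gt1 N_gt0 urec tau0 tau1 tau2 taurec N0 N1 N2 Hu.
rewrite -/t0 -/t1 -/t2 in E; set X := trib_coef t0 t1 t2 in E.
have XM (nu : {rmorphism algC -> algC}) a : nu (X a) = X (nu a) by apply: trib_coef_rmorph.
have X1n0 : X a1 != 0.
  apply/eqP => X10; have := trib_coef_prod t0 t1 t2 ta; rewrite -/X X10 !mul0r => /esym/eqP.
  by rewrite mulf_eq0 pnatr_eq0 /= intr_eq0 (negPf nz).
have unit_w (nu : {rmorphism algC -> algC}) (w : algC) : w ^+ N = 1 -> nu w * (nu w)^* = 1.
  by move=> wN; apply: (normC_unity N_gt0); rewrite -rmorphXn wN rmorph1.
have w_n0 (w : algC) : w ^+ N = 1 -> w != 0.
  by move=> wN; have := oner_neq0 algC; rewrite -wN expf_eq0 N_gt0.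
have XC1 : (X a1)^* = X a1 by rewrite XM /= c1.
have XC2 : (X a2)^* = X a3 by rewrite XM /= c2.
have XC3 : (X a3)^* = X a2 by rewrite XM /= c3.
(* Here [isosceles] constrains the images [nu v_i]; injectivity of [nu] carries the relation back to
   the [v_i]. *)
have iso (nu : {rmorphism algC -> algC}) (v1 v2 v3 : algC) :
    v1 ^+ N = 1 -> v2 ^+ N = 1 -> v3 ^+ N = 1 ->
    nu v1 * X a1 + nu v2 * X a2 + nu v3 * X a3 = 0 -> v2 * v3 = v1 ^+ 2.
  move=> /(unit_w nu) U1 /(unit_w nu) U2 /(unit_w nu) U3.
  move/(isosceles XC1 XC2 XC3 X1n0 U1 U2 U3).
  by rewrite -rmorphM -rmorphXn => /fmorph_inj.
have e1 := iso idfun _ _ _ u1 u2 u3 E.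
have [nu nu1] := trib_rmorph ta.
have Enu : nu w1 * X (nu a1) + nu w2 * X (nu a2) + nu w3 * X (nu a3) = 0.
  by rewrite -!XM -!rmorphM -!rmorphD E rmorph0.
have tnu := trib_roots_rmorph nu ta.
have e23 : w1 * w3 = w2 ^+ 2 \/ w1 * w2 = w3 ^+ 2.
  (* Either [nu] exchanges [a1] and [a2] or it permutes the roots cyclically; the coefficient of
     [X a1] becomes [nu w2] or [nu w3] respectively. *)
  have := trib_rootsE ta (trib_rootsC tnu); rewrite !inE => /or3P[]/eqP nu2.
  - left; have nu3 : nu a3 = a3.
      have := tr_sum tnu; rewrite nu1 nu2 -(tr_sum ta) [a2 + a1]addrC; exact: addrI.
    apply: (iso nu) => //; rewrite -[RHS]Enu nu1 nu2 nu3; ring.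
  - by have := trib_neq tnu; rewrite nu1 nu2 eqxx.
  right; have nu3 : nu a3 = a1.
    have := tr_sum tnu; rewrite nu1 nu2 => H.
    by apply: (addrI (a2 + a3)); rewrite H -(tr_sum ta); ring.
  apply: (iso nu) => //; rewrite -[RHS]Enu nu1 nu2 nu3; ring.
have /eqP := sum_cubes_eq0 (w_n0 _ u1) (w_n0 _ u2) (w_n0 _ u3) E e1 e23.
rewrite /X trib_coef_sumsq // !mulf_eq0 pnatr_eq0 /= intr_eq0.
have := trib_coef_sum ta 0 (erefl t0) (erefl t1) (erefl t2) urec.
rewrite !expr0 !mul1r => ->.
by rewrite mulf_eq0 pnatr_eq0 /= intr_eq0 => /orP[]/eqP; [left | right].
Qed.

End TwistedZero.

(** * Lifting periods *)

Definition tribonacci (s : Z -> Z) : Prop :=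
  forall n, s (n + 3) = s (n + 2) + s (n + 1) + s n.

Lemma T_of_nat (k : nat) : T (Z.of_nat k) = first3 (Nat.iter k trib_step (0, 1, 1)).
Proof.
destruct k as [|k]; [reflexivity|].
cbn [Z.of_nat T]; now rewrite SuccNat2Pos.id_succ.
Qed.

Lemma T_opp_nat (k : nat) : T (- Z.of_nat k) = first3 (Nat.iter k trib_back (0, 1, 1)).
Proof.
destruct k as [|k]; [reflexivity|].
cbn [Z.of_nat T Z.opp]; now rewrite SuccNat2Pos.id_succ.
Qed.

Lemma T_tribonacci : tribonacci T.
Proof.
assert (fwd : forall k : nat, Nat.iter k trib_step (0, 1, 1) =
    (T (Z.of_nat k), T (Z.of_nat k + 1), T (Z.of_nat k + 2))).
{ intros k.
  replace (Z.of_nat k + 1) with (Z.of_nat (S k)) by lia.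
  replace (Z.of_nat k + 2) with (Z.of_nat (S (S k))) by lia.
  rewrite !T_of_nat; cbn [Nat.iter nat_rect].
  unfold Nat.iter; cbn [nat_rect].
  now destruct (nat_rect _ _ _ k) as [[a b] c]. }
assert (bwd : forall k : nat, Nat.iter k trib_back (0, 1, 1) =
    (T (- Z.of_nat k), T (- Z.of_nat k + 1), T (- Z.of_nat k + 2))).
{ induction k as [|k IHk]; [reflexivity|].
  pose proof (T_opp_nat (S k)) as E.
  change (Nat.iter (S k) trib_back (0, 1, 1))
    with (trib_back (Nat.iter k trib_back (0, 1, 1))) in *.
  rewrite IHk in E |- *; cbn [trib_back first3] in *.
  replace (- Z.of_nat (S k) + 1) with (- Z.of_nat k) by lia.
  replace (- Z.of_nat (S k) + 2) with (- Z.of_nat k + 1) by lia.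
  now rewrite E. }
intros n; destruct (Z.le_gt_cases 0 n) as [n0 | n0].
- rewrite <- (Z2Nat.id n n0); set (k := Z.to_nat n).
  pose proof (fwd (S k)) as E.
  change (Nat.iter (S k) trib_step (0, 1, 1))
    with (trib_step (Nat.iter k trib_step (0, 1, 1))) in E.
  rewrite fwd in E; cbn [trib_step] in E; apply (f_equal snd) in E; cbn [snd] in E.
  replace (Z.of_nat k + 3) with (Z.of_nat (S k) + 2) by lia; lia.
- replace n with (- Z.of_nat (S (Z.to_nat (- n - 1)))) by lia.
  set (k := Z.to_nat _).
  pose proof (bwd (S k)) as E.
  change (Nat.iter (S k) trib_back (0, 1, 1))
    with (trib_back (Nat.iter k trib_back (0, 1, 1))) in E.
  rewrite bwd in E; cbn [trib_back] in E; apply (f_equal first3) in E; cbn [first3] in E.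
  replace (- Z.of_nat (S k) + 3) with (- Z.of_nat k + 2) by lia.
  replace (- Z.of_nat (S k) + 2) with (- Z.of_nat k + 1) by lia.
  replace (- Z.of_nat (S k) + 1) with (- Z.of_nat k) by lia; lia.
Qed.

Lemma tribonacci_ext (s s' : Z -> Z) : tribonacci s -> tribonacci s' ->
  s 0 = s' 0 -> s 1 = s' 1 -> s 2 = s' 2 -> forall n, s n = s' n.
Proof.
intros Hs Hs' e0 e1 e2.
assert (H : forall k : nat,
  (s (Z.of_nat k) = s' (Z.of_nat k) /\ s (Z.of_nat k + 1) = s' (Z.of_nat k + 1) /\
   s (Z.of_nat k + 2) = s' (Z.of_nat k + 2)) /\
  (s (- Z.of_nat k) = s' (- Z.of_nat k) /\ s (- Z.of_nat k + 1) = s' (- Z.of_nat k + 1) /\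
   s (- Z.of_nat k + 2) = s' (- Z.of_nat k + 2))).
{ induction k as [|k [[IH1 [IH2 IH3]] [IH4 [IH5 IH6]]]]; [now cbn|].
  pose proof (Hs (Z.of_nat k)); pose proof (Hs' (Z.of_nat k)).
  pose proof (Hs (- Z.of_nat (S k))); pose proof (Hs' (- Z.of_nat (S k))).
  replace (Z.of_nat (S k) + 1) with (Z.of_nat k + 2) by lia.
  replace (Z.of_nat (S k) + 2) with (Z.of_nat k + 3) by lia.
  replace (- Z.of_nat (S k) + 3) with (- Z.of_nat k + 2) in * by lia.
  replace (- Z.of_nat (S k) + 2) with (- Z.of_nat k + 1) in * by lia.
  replace (- Z.of_nat (S k) + 1) with (- Z.of_nat k) in * by lia.
  replace (Z.of_nat (S k)) with (Z.of_nat k + 1) in * by lia.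
  repeat split; lia. }
intros n; destruct (Z.le_gt_cases 0 n).
- replace n with (Z.of_nat (Z.to_nat n)) by lia; apply H.
- replace n with (- Z.of_nat (Z.to_nat (- n))) by lia; apply H.
Qed.

Lemma tribonacci_shift s k : tribonacci s -> tribonacci (fun n => s (n + k)).
Proof.
intros Hs n; rewrite <- !(Z.add_shuffle0 _ k); apply Hs.
Qed.

Lemma tribonacci_lin a b s s' : tribonacci s -> tribonacci s' ->
  tribonacci (fun n => a * s n + b * s' n).
Proof. intros Hs Hs' n; rewrite Hs, Hs'; ring. Qed.

(* The matrix of the windows of [T] at 0, 1, 2 is unimodular. *)
Lemma tribonacci_window s : tribonacci s -> exists b0 b1 b2,
  forall n, s n = b0 * T n + b1 * T (n + 1) + b2 * T (n + 2).
Proof.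
intros Hs.
exists (2 * s 1 - s 2), (2 * s 0 + s 1 - s 2), (s 2 - s 1 - s 0).
pose proof T_tribonacci as HT.
apply tribonacci_ext; [exact Hs | | cbn beta ..].
- pose proof (tribonacci_lin 1 (s 2 - s 1 - s 0) _ _
    (tribonacci_lin (2 * s 1 - s 2) (2 * s 0 + s 1 - s 2) _ _ HT (tribonacci_shift T 1 HT))
    (tribonacci_shift T 2 HT)) as H.
  intros n; generalize (H n); cbn beta; lia.
- change (T 0) with 0; change (T (0 + 1)) with 1; change (T (0 + 2)) with 1; ring.
- change (T 1) with 1; change (T (1 + 1)) with 1; change (T (1 + 2)) with 2; ring.
- change (T 2) with 1; change (T (2 + 1)) with 2; change (T (2 + 2)) with 4; ring.
Qed.

(** The pointwise quotient again satisfies the recurrence, because [P] can be cancelled. *)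
Lemma tribonacci_quot M l P : P <> 0 ->
  (forall n, exists E, T (n + M) = l * T n + P * E) ->
  exists D, tribonacci D /\ forall n, T (n + M) = l * T n + P * D n.
Proof.
intros P0 H; set (D := fun n => (T (n + M) - l * T n) / P).
assert (DE : forall n, T (n + M) = l * T n + P * D n).
{ intros n; unfold D; destruct (H n) as [E ->].
  replace (_ - l * T n) with (E * P) by ring; rewrite Z.div_mul by exact P0; ring. }
exists D; split; [|exact DE].
intros n; apply (Z.mul_reg_l _ _ P P0).
pose proof (tribonacci_lin 1 (- l) _ _ (tribonacci_shift T M T_tribonacci) T_tribonacci n) as H'.
cbn beta in H'; rewrite !DE in H'; lia.
Qed.

(** Every solution is an integral combination of shifts of [T], so it inherits the relation. *)
Lemma tribonacci_mul_add M l P D s : tribonacci D -> tribonacci s ->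
  (forall n, T (n + M) = l * T n + P * D n) ->
  exists D', tribonacci D' /\ forall n, s (n + M) = l * s n + P * D' n.
Proof.
intros HD Hs HM; destruct (tribonacci_window s Hs) as [b0 [b1 [b2 E]]].
exists (fun n => b0 * D n + b1 * D (n + 1) + b2 * D (n + 2)); split.
- pose proof (tribonacci_lin 1 b2 _ _ (tribonacci_lin b0 b1 _ _ HD (tribonacci_shift D 1 HD))
    (tribonacci_shift D 2 HD)) as H.
  intros n; generalize (H n); cbn beta; lia.
- intros n; rewrite (E (n + M)), (E n), (Z.add_shuffle0 n M 1), (Z.add_shuffle0 n M 2), !HM.
  ring.
Qed.

Section Lift.

Variables (M l P : Z) (D : Z -> Z).
Hypothesis HD : tribonacci D.
Hypothesis HM : forall n, T (n + M) = l * T n + P * D n.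

(** With [D] viewed as an operator, the shift by [M] is [l + P D]; this expands its power [k + 1] up
    to terms in [P ^ 2]. *)
Lemma T_add_mul (k : Z) : 0 <= k -> forall n, exists E,
  T (n + (k + 1) * M) = l ^ (k + 1) * T n + P * ((k + 1) * l ^ k * D n + P * E).
Proof.
destruct (tribonacci_mul_add M l P D D HD HD HM) as [D2 [HD2 E2]].
intros k0; pattern k; apply natlike_ind; [| | exact k0]; clear k k0.
- intros n; exists 0; rewrite Z.add_0_l, Z.mul_1_l, HM, Z.pow_1_r, Z.pow_0_r; ring.
- intros k k0 IHk n; destruct (IHk (n + M)) as [E EE].
  exists ((k + 1) * l ^ k * D2 n + E).
  replace (n + (Z.succ k + 1) * M) with (n + M + (k + 1) * M) by ring.
  rewrite EE, HM, E2, <- Z.add_1_r, !Z.pow_add_r by lia; ring.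
Qed.

(** The expansion to second order; [c] is the binomial coefficient of [k + 2] over 2, described
    without division. *)
Lemma T_add_mul2 (k : Z) : 0 <= k -> forall n, exists c D2 E,
  2 * c = (k + 2) * (k + 1) /\
  T (n + (k + 2) * M) = l ^ (k + 2) * T n + (k + 2) * l ^ (k + 1) * P * D n
    + c * P ^ 2 * D2 + P ^ 3 * E.
Proof.
destruct (tribonacci_mul_add M l P D D HD HD HM) as [D2 [HD2 E2]].
destruct (tribonacci_mul_add M l P D D2 HD HD2 HM) as [D3 [HD3 E3]].
intros k0 n.
enough (H : exists c E, 2 * c = (k + 2) * (k + 1) /\
  T (n + (k + 2) * M) = l ^ (k + 2) * T n + (k + 2) * l ^ (k + 1) * P * D n
    + c * P ^ 2 * (l ^ k * D2 n) + P ^ 3 * E).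
{ destruct H as [c [E H]]; exists c, (l ^ k * D2 n), E; exact H. }
revert n; pattern k; apply natlike_ind; [| | exact k0]; clear k k0.
- intros n; exists 1, 0; split; [reflexivity|].
  replace (n + (0 + 2) * M) with (n + M + M) by ring.
  rewrite !HM, E2; change (0 + 2) with 2; change (0 + 1) with 1.
  rewrite Z.pow_0_r; ring.
- intros k k0 IHk n; destruct (IHk (n + M)) as [c [E [cE EE]]].
  exists (c + (k + 2)), (c * l ^ k * D3 n + E); split; [lia|].
  replace (n + (Z.succ k + 2) * M) with (n + M + (k + 2) * M) by ring.
  rewrite EE, HM, E2, E3, <- Z.add_1_r, !Z.pow_add_r by lia; ring.
Qed.

(* As [p] is odd, it divides the binomial coefficient [p (p - 1) / 2]. *)
Lemma lift_step (p h : Z) : p = 2 * h + 1 -> 1 <= h -> P <> 0 -> (p | P) ->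
  exists D', tribonacci D' /\
    (forall n, T (n + p * M) = l ^ p * T n + p * P * D' n) /\
    (forall n, (p | D' n - l ^ (p - 1) * D n)).
Proof.
intros ph h1 Pn0 [P' PE].
assert (H : forall n, exists E,
  T (n + p * M) = l ^ p * T n + p * P * (l ^ (p - 1) * D n + p * E)).
{ intros n; destruct (T_add_mul2 (p - 2) ltac:(lia) n) as [c [D2 [E [cE EE]]]].
  assert (cE' : c = p * h) by nia.
  exists (h * P' * D2 + P' * P' * E).
  replace (p - 2 + 2) with p in * by ring; replace (p - 2 + 1) with (p - 1) in * by ring.
  rewrite EE, cE'.
  replace (P ^ 2) with (P * (P' * p)) by (rewrite <- PE; ring).
  replace (P ^ 3) with (P * (P' * p) * (P' * p)) by (rewrite <- PE; ring); ring. }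
assert (pPn0 : p * P <> 0) by nia.
destruct (tribonacci_quot (p * M) (l ^ p) (p * P) pPn0) as [D' [HD' D'E]].
{ intros n; destruct (H n) as [E ->]; eexists; reflexivity. }
exists D'; split; [exact HD'|]; split; [exact D'E|].
intros n; destruct (H n) as [E EE]; rewrite D'E in EE; exists E.
apply (Z.mul_reg_l _ _ (p * P) pPn0); lia.
Qed.

End Lift.

(** Iterates [lift_step]: modulo [p], [D] changes only by a power of [l], so simplicity of a zero
    survives the lifting when [l] is prime to [p]. *)
Lemma lift (p h M l : Z) (D : Z -> Z) : p = 2 * h + 1 -> 1 <= h -> tribonacci D ->
  (forall n, T (n + M) = l * T n + p * D n) ->
  forall e, 0 <= e -> exists D' j, tribonacci D' /\ 0 <= j /\
    (forall n, T (n + p ^ e * M) = l ^ (p ^ e) * T n + p ^ (e + 1) * D' n) /\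
    (forall n, (p | D' n - l ^ j * D n)).
Proof.
intros ph h1 HD HM e e0; pattern e; apply natlike_ind; [| | exact e0]; clear e e0.
- exists D, 0; repeat split; [exact HD | lia | |].
  + intros n; rewrite Z.pow_0_r, Z.mul_1_l, !Z.pow_1_r; apply HM.
  + intros n; exists 0; rewrite Z.pow_0_r; ring.
- intros e e0 [D1 [j [HD1 [j0 [HM1 Hj]]]]].
  assert (pe : 0 < p ^ e) by (apply Z.pow_pos_nonneg; lia).
  destruct (lift_step (p ^ e * M) (l ^ (p ^ e)) (p ^ (e + 1)) D1 HD1 HM1 p h ph h1)
    as [D2 [HD2 [HM2 Hj2]]].
  { apply Z.pow_nonzero; lia. }
  { rewrite Z.pow_add_r, Z.pow_1_r by lia; apply Z.divide_factor_r. }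
  exists D2, (p ^ e * (p - 1) + j); repeat split; [exact HD2 | nia | |].
  + intros n; rewrite <- Z.add_1_r.
    replace (p ^ (e + 1) * M) with (p * (p ^ e * M)) by (rewrite (Z.pow_add_r p e 1); lia).
    rewrite HM2, <- Z.pow_mul_r by lia.
    replace (p ^ e * p) with (p ^ (e + 1)) by (rewrite Z.pow_add_r; lia).
    rewrite (Z.pow_add_r p (e + 1) 1), Z.pow_1_r by lia; ring.
  + intros n; rewrite Z.pow_add_r, Z.pow_mul_r by nia.
    replace (D2 n - _) with ((D2 n - (l ^ p ^ e) ^ (p - 1) * D1 n)
      + (l ^ p ^ e) ^ (p - 1) * (D1 n - l ^ j * D n)) by ring.
    apply Z.divide_add_r; [apply Hj2 | apply Z.divide_mul_r, Hj].
Qed.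

(** * Valuations near a rational zero *)

Module Valuation.
Import all_boot.

Lemma prime_Z_of_nat (p : nat) : prime.prime p = true -> Znumtheory.prime (Z.of_nat p).
Proof.
move=> pp; have p1 := prime_gt1 pp; apply/prime_alt; split; first by move/ltP: p1; lia.
move=> n [n1 np] [q qE].
have [d1 d2] : (1 < Z.to_nat n)%coq_nat /\ (Z.to_nat n < p)%coq_nat by lia.
have /(primeP pp).2 : (Z.to_nat n %| p)%N.
  apply/dvdnP; exists (Z.to_nat q); rewrite -multE; nia.
by case/orP => /eqP; lia.
Qed.

Lemma Z_of_nat_expn (p k : nat) : Z.of_nat (expn p k) = Z.of_nat p ^ Z.of_nat k.
Proof.
elim: k => [//|k IHk]; rewrite expnS -multE Nat2Z.inj_mul IHk.
by rewrite Nat2Z.inj_succ Z.pow_succ_r //; lia.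
Qed.

Lemma vp_exp_mul (p k : nat) (u : Z) : prime.prime p = true ->
  ~ (Z.of_nat p | u) -> vp p (Z.of_nat p ^ Z.of_nat k * u) = Some k.
Proof.
move=> pp pu; have p_gt0 : (0 < p)%N := prime_gt0 pp.
have u0 : u <> 0 by move=> u0; apply: pu; rewrite u0; apply: Z.divide_0_r.
have pk0 : Z.of_nat p ^ Z.of_nat k <> 0.
  by rewrite -Z_of_nat_expn; have /ltP : (0 < expn p k)%N by [rewrite expn_gt0 p_gt0]; lia.
rewrite /vp; case: Z.eqb_spec => [E|_]; first by nia.
rewrite Zabs2Nat.inj_mul -Z_of_nat_expn Zabs2Nat.id multE.
have au_gt0 : (0 < Z.abs_nat u)%N by apply/ltP; lia.
rewrite lognM ?expn_gt0 ?p_gt0 // pfactorK // logn_coprime ?addn0 //.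
rewrite prime_coprime //; apply/negP => /dvdnP[q qE]; apply: pu.
by apply/Z.divide_abs_r; exists (Z.of_nat q); rewrite -Zabs2Nat.id_abs qE -multE Nat2Z.inj_mul.
Qed.

End Valuation.
Import Valuation.

Lemma exp_mul_ex (p : Z) : 1 < p -> forall z, z <> 0 ->
  exists (k : nat) u, z = p ^ Z.of_nat k * u /\ ~ (p | u).
Proof.
intros p1.
enough (H : forall b : nat, forall z, z <> 0 -> Z.abs z < Z.of_nat b ->
  exists (k : nat) u, z = p ^ Z.of_nat k * u /\ ~ (p | u)).
{ intros z z0; apply (H (S (Z.abs_nat z))); lia. }
induction b as [|b IHb]; intros z z0 zb; [lia|].
destruct (Zdivide_dec p z) as [[q ->] | pz].
- destruct (IHb q ltac:(nia) ltac:(nia)) as [k [u [-> pu]]].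
  exists (S k), u; split; [|exact pu].
  rewrite Nat2Z.inj_succ, Z.pow_succ_r by lia; ring.
- exists 0%nat, z; split; [now rewrite Z.mul_1_l | exact pz].
Qed.

Lemma not_divide_mul p a b : Znumtheory.prime p -> ~ (p | a) -> ~ (p | b) -> ~ (p | a * b).
Proof. intros pp pa pb H; destruct (prime_mult p pp a b H); auto. Qed.

Lemma not_divide_pow p a k : Znumtheory.prime p -> ~ (p | a) -> 0 <= k -> ~ (p | a ^ k).
Proof.
intros pp pa k0; pattern k; apply natlike_ind; [| | exact k0].
- intros H; apply Z.divide_1_r_nonneg in H; pose proof (prime_ge_2 p pp); lia.
- intros j j0 IH; rewrite Z.pow_succ_r by lia; now apply not_divide_mul.
Qed.

Lemma not_divide_sub p a b : (p | a - b) -> ~ (p | b) -> ~ (p | a).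
Proof.
intros H pb pa; apply pb; replace b with (a - (a - b)) by ring.
now apply Z.divide_sub_r.
Qed.

Lemma T_mul_period p M l D s k n : tribonacci D -> tribonacci s ->
  (forall n, T (n + M) = l * T n + p * D n) -> 0 <= k ->
  (p | s (n + k * M) - l ^ k * s n).
Proof.
intros HD Hs HM; destruct (tribonacci_mul_add M l p D s HD Hs HM) as [D' [_ HD']].
intros k0; revert n; pattern k; apply natlike_ind; [| | exact k0].
- intros n; exists 0; rewrite Z.mul_0_l, Z.add_0_r, Z.pow_0_r; ring.
- intros j j0 IH n; replace (n + Z.succ j * M) with (n + j * M + M) by ring.
  rewrite HD', Z.pow_succ_r by lia.
  replace (_ - _) with (l * (s (n + j * M) - l ^ j * s n) + p * D' (n + j * M)) by ring.
  apply Z.divide_add_r; [apply Z.divide_mul_r, IH | apply Z.divide_factor_l].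
Qed.

Section RationalZero.

Variables (p : nat) (h M l a : Z) (D : Z -> Z).
Let P := Z.of_nat p.
Hypothesis pp : prime.prime p = true.
Hypothesis ph : P = 2 * h + 1.
Hypothesis lP : ~ (P | l).
Hypothesis M_pos : 0 < M.
Hypothesis MP : ~ (P | M).
Hypothesis HD : tribonacci D.
Hypothesis HM : forall n, T (n + M) = l * T n + P * D n.

Let pZ : Znumtheory.prime P := prime_Z_of_nat p pp.

Lemma T_not_divide n k : ~ (P | T n) -> ~ (P | T (n + k * M)).
Proof.
destruct (Z.le_gt_cases 0 k) as [k0 | k0]; intros Pn.
- apply (not_divide_sub _ _ _ (T_mul_period P M l D T k n HD T_tribonacci HM k0)).
  apply not_divide_mul; [exact pZ | now apply not_divide_pow | exact Pn].
- intros H; apply Pn.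
  pose proof (T_mul_period P M l D T (- k) (n + k * M) HD T_tribonacci HM ltac:(lia)) as E.
  replace (n + k * M + - k * M) with n in E by ring.
  replace (T n) with ((T n - l ^ (- k) * T (n + k * M)) + l ^ (- k) * T (n + k * M)) by ring.
  apply Z.divide_add_r; [exact E | now apply Z.divide_mul_r].
Qed.

Hypothesis Ta : T a = 0.
Hypothesis Da : ~ (P | D a).

(** Write [k = P ^ e * k'] with [k'] prime to [P]. Over the lifted period [M'], the first-order
    expansion exhibits [P ^ (e + 1)] times a factor prime to [P], while [e] is the valuation of
    [k * M]. *)
Lemma vp_T_zero k : vp p (T (a + k * M)) = option_map S (vp p (k * M)).
Proof.
pose proof (prime_ge_2 P pZ) as P2.
destruct (Z.eq_dec k 0) as [-> | k0].
{ now rewrite Z.mul_0_l, Z.add_0_r, Ta. }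
destruct (exp_mul_ex P ltac:(lia) k k0) as [e [k' [kE Pk']]].
assert (eM : vp p (k * M) = Some e).
{ rewrite kE, <- Z.mul_assoc; apply vp_exp_mul; [exact pp | now apply not_divide_mul]. }
rewrite eM; cbn [option_map].
destruct (lift P h M l D ph ltac:(lia) HD HM (Z.of_nat e) ltac:(lia))
  as [D' [j [HD' [j0 [HM' Hj]]]]].
set (L := l ^ P ^ Z.of_nat e) in *; set (M' := P ^ Z.of_nat e * M) in *.
assert (e1 : Z.of_nat e + 1 = Z.of_nat (S e)) by lia; rewrite e1 in HM'.
assert (PL : ~ (P | L)).
{ apply not_divide_pow; [exact pZ | exact lP | apply Z.pow_nonneg; lia]. }
assert (Pe : (P | P ^ Z.of_nat (S e))).
{ rewrite Nat2Z.inj_succ, Z.pow_succ_r by lia; apply Z.divide_factor_l. }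
assert (unit : forall n q E, 0 <= q -> ~ (P | D n) -> ~ (P | q + 1) ->
  ~ (P | (q + 1) * L ^ q * D' n + P ^ Z.of_nat (S e) * E)).
{ intros n q E q0 Dn Pq.
  apply (not_divide_sub _ _ ((q + 1) * L ^ q * D' n)).
  { rewrite Z.add_simpl_l; now apply Z.divide_mul_l. }
  repeat apply not_divide_mul; try assumption; [now apply not_divide_pow|].
  apply (not_divide_sub _ _ _ (Hj n)); apply not_divide_mul; [exact pZ | | exact Dn].
  now apply not_divide_pow. }
assert (kME : k * M = k' * M') by (rewrite kE; unfold M'; ring).
rewrite kME; destruct (Z.le_gt_cases 0 k') as [k'0 | k'0].
- assert (k'n0 : k' <> 0) by (intros ->; lia).
  destruct (T_add_mul M' L _ D' HD' HM' (k' - 1) ltac:(lia) a) as [E EE].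
  replace (k' - 1 + 1) with k' in EE by ring.
  rewrite EE, Ta, Z.mul_0_r, Z.add_0_l; apply vp_exp_mul; [exact pp|].
  pose proof (unit a (k' - 1) E ltac:(lia) Da) as U.
  replace (k' - 1 + 1) with k' in U by ring; now apply U.
(* For negative [k'] the expansion runs from [a + k' * M'] up to [a], where [T] vanishes. *)
- destruct (T_add_mul M' L _ D' HD' HM' (- k' - 1) ltac:(lia) (a + k' * M')) as [E EE].
  replace (- k' - 1 + 1) with (- k') in EE by ring.
  replace (a + k' * M' + - k' * M') with a in EE by ring; rewrite Ta in EE.
  assert (Dn : ~ (P | D (a + k' * M'))).
  { assert (Hk : 0 <= - k' * P ^ Z.of_nat e).
    { apply Z.mul_nonneg_nonneg; [lia | apply Z.pow_nonneg; lia]. }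
    pose proof (T_mul_period P M l D D _ (a + k' * M') HD HD HM Hk) as H.
    replace (a + k' * M' + _ * M) with a in H by (unfold M'; ring).
    intros Dn; apply Da.
    replace (D a) with ((D a - l ^ (- k' * P ^ Z.of_nat e) * D (a + k' * M'))
      + l ^ (- k' * P ^ Z.of_nat e) * D (a + k' * M')) by ring.
    apply Z.divide_add_r; [exact H | now apply Z.divide_mul_r]. }
  assert (Pk : ~ (P | - k')) by now rewrite Z.divide_opp_r.
  pose proof (unit _ (- k' - 1) E ltac:(lia) Dn) as U.
  replace (- k' - 1 + 1) with (- k') in U by ring; specialize (U Pk).
  set (u := _ + _) in U; fold u in EE.
  assert (PLk : ~ (P | L ^ (- k'))) by (apply not_divide_pow; [exact pZ | exact PL | lia]).
  assert (div : (P ^ Z.of_nat (S e) | T (a + k' * M'))).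
  { apply (Gauss _ (L ^ (- k'))).
    - exists (- u); lia.
    - apply rel_prime_Zpower_r; [lia|].
      apply rel_prime_sym, rel_prime_Zpower_r; [lia|].
      now apply rel_prime_sym, prime_rel_prime. }
  destruct div as [w wE]; rewrite wE, Z.mul_comm; apply vp_exp_mul; [exact pp|].
  intros Pw; apply U.
  assert (Pn0 : P ^ Z.of_nat (S e) <> 0) by (apply Z.pow_nonzero; lia).
  replace u with (- (L ^ (- k') * w)).
  { apply Z.divide_opp_r; now apply Z.divide_mul_r. }
  apply (Z.mul_reg_l _ _ _ Pn0); rewrite wE in EE; lia.
Qed.

End RationalZero.

(** * Fast evaluation of [T] modulo [m] *)

(* The triple [(a, b, c)] stands for the polynomial [a + b x + c x ^ 2], acting on
   sequences with [x] as the shift. *)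
Definition act (t : Z * Z * Z) (n : Z) : Z :=
  let '(a, b, c) := t in a * T n + b * T (n + 1) + c * T (n + 2).

(** Reduction by [x^3 = x^2 + x + 1] and [x^4 = 2 x^2 + 2 x + 1]; [d3] and [d4] are the coefficients
    of [x^3] and [x^4]. *)
Definition mul_mod (m : Z) (t u : Z * Z * Z) : Z * Z * Z :=
  let '(a, b, c) := t in
  let '(a', b', c') := u in
  let d3 := b * c' + c * b' in
  let d4 := c * c' in
  ((a * a' + d3 + d4) mod m, (a * b' + b * a' + d3 + 2 * d4) mod m,
   (a * c' + b * b' + c * a' + d3 + 2 * d4) mod m).

(** Repeated squaring, which makes [T] computable modulo [m] at indices of eight digits. *)
Fixpoint shift_pow (m : Z) (k : positive) : Z * Z * Z :=
  match k with
  | xH => (0, 1, 0)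
  | xO k => let t := shift_pow m k in mul_mod m t t
  | xI k => let t := shift_pow m k in mul_mod m (mul_mod m t t) (0, 1, 0)
  end.

Definition represents (m : Z) (t : Z * Z * Z) (k : Z) : Prop :=
  forall n, (m | T (n + k) - act t n).

Lemma divide_sub_mod m a : (m | a - a mod m).
Proof.
exists (a / m); pose proof (Z_div_mod_eq_full a m); lia.
Qed.

Lemma represents_mul m t u j k : represents m t j -> represents m u k ->
  represents m (mul_mod m t u) (j + k).
Proof.
destruct t as [[a b] c], u as [[a' b'] c']; intros Ht Hu n; unfold mul_mod, act.
set (d3 := b * c' + c * b'); set (d4 := c * c').
set (x := a * a' + d3 + d4); set (y := a * b' + b * a' + d3 + 2 * d4).
set (z := a * c' + b * b' + c * a' + d3 + 2 * d4).
pose proof (Ht (n + k)) as H; pose proof (Hu n) as H0; pose proof (Hu (n + 1)) as H1.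
pose proof (Hu (n + 2)) as H2; unfold act in *.
replace (n + k + j) with (n + (j + k)) in H by ring.
replace (n + 1 + k) with (n + k + 1) in H1 by ring.
replace (n + 2 + k) with (n + k + 2) in H2 by ring.
pose proof (T_tribonacci n) as R0; pose proof (T_tribonacci (n + 1)) as R1.
replace (n + 1 + 1) with (n + 2) in * by ring.
replace (n + 1 + 2) with (n + 3) in * by ring.
replace (n + 2 + 1) with (n + 3) in * by ring.
replace (n + 2 + 2) with (n + 1 + 3) in * by ring.
destruct H as [q E], H0 as [q0 E0], H1 as [q1 E1], H2 as [q2 E2].
destruct (divide_sub_mod m x) as [qx Ex], (divide_sub_mod m y) as [qy Ey].
destruct (divide_sub_mod m z) as [qz Ez].
exists (q + a * q0 + b * q1 + c * q2 + qx * T n + qy * T (n + 1) + qz * T (n + 2)).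
rewrite R1, R0 in E2; rewrite R0 in E1.
replace (x mod m) with (x - qx * m) by lia; replace (y mod m) with (y - qy * m) by lia.
replace (z mod m) with (z - qz * m) by lia.
replace (T (n + (j + k))) with
  (q * m + (a * T (n + k) + b * T (n + k + 1) + c * T (n + k + 2))) by lia.
replace (T (n + k)) with (q0 * m + (a' * T n + b' * T (n + 1) + c' * T (n + 2))) by lia.
replace (T (n + k + 1)) with (q1 * m + (a' * T (n + 1) + b' * T (n + 2) +
  c' * (T (n + 2) + T (n + 1) + T n))) by lia.
replace (T (n + k + 2)) with (q2 * m + (a' * T (n + 2) + b' * (T (n + 2) + T (n + 1) + T n) +
  c' * (T (n + 2) + T (n + 1) + T n + T (n + 2) + T (n + 1)))) by lia.
unfold x, y, z, d3, d4; ring.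
Qed.

Lemma represents_pow m k : represents m (shift_pow m k) (Zpos k).
Proof.
assert (H1 : represents m (0, 1, 0) 1).
{ intros n; exists 0; unfold act; ring. }
induction k as [k IHk | k IHk |]; cbn [shift_pow]; [| | exact H1].
- replace (Zpos k~1) with (Zpos k + Zpos k + 1) by lia; auto using represents_mul.
- replace (Zpos k~0) with (Zpos k + Zpos k) by lia; auto using represents_mul.
Qed.

Lemma T_eq_mod m t k n : represents m t k -> (act t n) mod m = T (n + k) mod m.
Proof.
intros H; destruct (H n) as [q E].
replace (T (n + k)) with (act t n + q * m) by lia; now rewrite Z_mod_plus_full.
Qed.

(** For a triple representing the shift by [M], this says that [M] is a period of [T] modulo [p] up
    to the multiplier [l]. *)
Definition scalar_mod (p l : Z) (t : Z * Z * Z) : bool :=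
  let '(a, b, c) := t in (((a - l) mod p =? 0) && (b mod p =? 0) && (c mod p =? 0))%bool.

Lemma scalar_mod_mul_add p l m t M : 0 < p -> (p | m) -> represents m t M ->
  scalar_mod p l t = true ->
  exists D, tribonacci D /\ forall n, T (n + M) = l * T n + p * D n.
Proof.
destruct t as [[a b] c]; intros p0 pm Ht; unfold scalar_mod; rewrite !Bool.andb_true_iff.
intros [[Ha Hb] Hc]; apply Z.eqb_eq in Ha, Hb, Hc.
apply Z.mod_divide in Ha, Hb, Hc; try lia.
apply tribonacci_quot; [lia|]; intros n.
destruct (Z.divide_trans _ _ _ pm (Ht n)) as [q E], Ha as [qa Ea], Hb as [qb Eb],
  Hc as [qc Ec]; unfold act in E.
exists (q + qa * T n + qb * T (n + 1) + qc * T (n + 2)).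
replace a with (l + qa * p) in E by lia; rewrite Eb, Ec in E; lia.
Qed.

(** * The integral zeros of [T] and the primes 83 and 397 *)

Definition zeros : list Z := [0; -1; -4; -17].

Lemma T_zeros a : In a zeros -> T a = 0.
Proof. now intros [<- | [<- | [<- | [<- | []]]]]. Qed.

(** At a zero [a] one has [T (a + Q) = P * D a], so nonvanishing modulo [P * P] shows that the zero
    is simple; every other class modulo [Q] is tested on one representative. *)
Lemma valuation_formula (p : nat) (h l : Z) (Q : positive) :
  prime.prime p = true -> Z.of_nat p = 2 * h + 1 ->
  let P := Z.of_nat p in
  let t := shift_pow (P * P) Q in
  ((Zpos Q mod P =? 0) || (l mod P =? 0))%bool = false ->
  scalar_mod P l t = true ->
  forallb (fun a => negb (act t a mod (P * P) =? 0)) zeros = true ->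
  forallb (fun r => (existsb (fun a => a mod Zpos Q =? r) zeros || negb (T r mod P =? 0))%bool)
    (map Z.of_nat (seq 0 (Pos.to_nat Q))) = true ->
  forall n,
    (forall a, In a zeros -> n mod Zpos Q = a mod Zpos Q ->
       vp p (T n) = option_map S (vp p (n - a))) /\
    ((forall a, In a zeros -> n mod Zpos Q <> a mod Zpos Q) -> vp p (T n) = Some 0%nat).
Proof.
intros pp ph P t HQl Ht Hz Hr.
pose proof (prime_Z_of_nat p pp) as pZ; fold P in pZ, ph.
pose proof (prime_ge_2 P pZ) as P2.
rewrite Bool.orb_false_iff, !Z.eqb_neq in HQl; destruct HQl as [HQ Hl].
assert (Pl : ~ (P | l)) by (intros H; apply Hl, Z.mod_divide; [lia | exact H]).
assert (PQ : ~ (P | Zpos Q)) by (intros H; apply HQ, Z.mod_divide; [lia | exact H]).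
pose proof (represents_pow (P * P) Q) as Hrep; fold t in Hrep.
destruct (scalar_mod_mul_add P l (P * P) t (Zpos Q) ltac:(lia) (Z.divide_factor_l _ _) Hrep Ht)
  as [D [HD HM]].
rewrite forallb_forall in Hz, Hr.
intros n; split.
- intros a Ha nE.
  replace n with (a + (n / Zpos Q - a / Zpos Q) * Zpos Q) by
    (pose proof (Z_div_mod_eq_full n (Zpos Q)); pose proof (Z_div_mod_eq_full a (Zpos Q)); lia).
  set (k := _ - _); replace (a + k * Zpos Q - a) with (k * Zpos Q) by ring.
  apply (vp_T_zero p h (Zpos Q) l a D); try (assumption || reflexivity); [now apply T_zeros|].
  fold P; intros [q E]; specialize (Hz a Ha).
  rewrite (T_eq_mod _ _ (Zpos Q) a Hrep), HM, (T_zeros a Ha), E in Hz.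
  replace (l * 0 + P * (q * P)) with (q * (P * P)) in Hz by ring.
  now rewrite Z_mod_mult in Hz.
- intros Hn.
  set (r := n mod Zpos Q) in *; assert (r0 : 0 <= r < Zpos Q) by now apply Z.mod_pos_bound.
  specialize (Hr r); rewrite in_map_iff in Hr.
  assert (Pr : ~ (P | T r)).
  { intros H; apply Z.mod_divide in H; [|lia].
    rewrite H, Z.eqb_refl, Bool.orb_false_r, existsb_exists in Hr.
    destruct Hr as [a [Ha Ea]].
    - exists (Z.to_nat r); split; [lia | apply in_seq; lia].
    - apply Z.eqb_eq in Ea; now apply (Hn a). }
  pose proof (T_not_divide p (Zpos Q) l D pp Pl HD HM r (n / Zpos Q) Pr) as H.
  replace (r + n / Zpos Q * Zpos Q) with n in H
    by (unfold r; pose proof (Z_div_mod_eq_full n (Zpos Q)); lia).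
  rewrite <- (Z.mul_1_l (T n)); exact (vp_exp_mul p 0 (T n) pp H).
Qed.

Lemma valuation_formula_83_397 (p : nat) (Q : Z) :
  (p = 83%nat /\ Q = 287) \/ (p = 397%nat /\ Q = 132) -> forall n,
    (forall a, In a zeros -> n mod Q = a mod Q ->
       vp p (T n) = option_map S (vp p (n - a))) /\
    ((forall a, In a zeros -> n mod Q <> a mod Q) -> vp p (T n) = Some 0%nat).
Proof.
intros [[-> ->] | [-> ->]].
(* The multiplier [l] is the constant coefficient of the computed power of [x]. *)
- apply (valuation_formula 83 41 (fst (fst (shift_pow (83 * 83) 287))) 287);
    vm_compute; reflexivity.
- apply (valuation_formula 397 198 (fst (fst (shift_pow (397 * 397) 132))) 132);
    vm_compute; reflexivity.
Qed.

(** The 83-adic valuation of [T n] is infinite, so by the formula that of [n - a] is infinite for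
    some [a] in [zeros]. *)
Lemma T_eq_0 n : T n = 0 -> In n zeros.
Proof.
intros Tn; destruct (valuation_formula_83_397 83 287 ltac:(now left) n) as [Hz Hnz].
rewrite Tn in Hz, Hnz.
destruct (existsb (fun a => n mod 287 =? a mod 287) zeros) eqn:E.
- apply existsb_exists in E; destruct E as [a [Ha Ea]]; apply Z.eqb_eq in Ea.
  specialize (Hz a Ha Ea); unfold vp in Hz; cbn [Z.eqb] in Hz.
  destruct (Z.eqb_spec (n - a) 0) as [na | _]; [|discriminate].
  now replace n with a by lia.
- discriminate Hnz; intros a Ha Ea; rewrite <- Bool.not_true_iff_false in E; apply E.
  apply existsb_exists; exists a; split; [exact Ha | now apply Z.eqb_eq].
Qed.

(** Classes of zeros have type (L) with [kappa = mu = 1], all others type (C) with value 0; as [Q]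
    has valuation 0, the condition on [a - i] is immediate. *)
Lemma ML_of_valuation_formula (p : nat) (Q : Z) :
  0 < Q -> prime.logn p (Z.to_nat Q) = 0%nat ->
  (forall n, (forall a, In a zeros -> n mod Q = a mod Q ->
       vp p (T n) = option_map S (vp p (n - a))) /\
    ((forall a, In a zeros -> n mod Q <> a mod Q) -> vp p (T n) = Some 0%nat)) -> ML p.
Proof.
intros Q0 lQ H; exists Q; split; [exact Q0|]; intros i _.
destruct (existsb (fun a => i mod Q =? a mod Q) zeros) eqn:E.
- apply existsb_exists in E; destruct E as [a [Ha Ea]]; apply Z.eqb_eq in Ea.
  right; exists a, 1, 1; split; [lia|]; split.
  { rewrite lQ; destruct (vp p (a - i)); cbn; [lia | exact I]. }
  exists 0; intros n nE _; rewrite (proj1 (H n) a Ha) by congruence.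
  destruct (vp p (n - a)) as [k|]; [|reflexivity].
  cbn [option_map ext_affine]; f_equal; lia.
- left; exists 0%nat, 0; intros n nE _; apply (proj2 (H n)); intros a Ha Ea.
  rewrite <- Bool.not_true_iff_false in E; apply E.
  apply existsb_exists; exists a; split; [exact Ha | apply Z.eqb_eq; congruence].
Qed.

(** * p-adic zeros and ML *)

Section PadicZero.

Variables (p : nat) (h M n0 : Z) (D : Z -> Z).
Let P := Z.of_nat p.
Hypothesis pp : prime.prime p = true.
Hypothesis ph : P = 2 * h + 1.
Hypothesis HD : tribonacci D.
Hypothesis HM : forall n, T (n + M) = 1 * T n + P * D n.
Hypothesis Dn0 : ~ (P | D n0).

Let pZ : Znumtheory.prime P := prime_Z_of_nat p pp.

(** Up to [P ^ (2 * e + 2)], [T] is linear in [k] along the lifted period, with slope congruent to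
    [D n]. *)
Lemma T_add_period e n : 0 <= e -> exists D', (P | D' - D n) /\
  forall k, 1 <= k -> exists E,
    T (n + k * (P ^ e * M)) = T n + P ^ (e + 1) * (k * D' + P ^ (e + 1) * E).
Proof.
intros e0; pose proof (prime_ge_2 P pZ) as P2.
destruct (lift P h M 1 D ph ltac:(lia) HD HM e e0) as [D' [j [HD' [j0 [HM' Hj]]]]].
exists (D' n); split.
- specialize (Hj n); now rewrite Z.pow_1_l, Z.mul_1_l in Hj by exact j0.
- intros k k1; destruct (T_add_mul _ _ _ D' HD' HM' (k - 1) ltac:(lia) n) as [E EE].
  exists E; rewrite Z.sub_add, !Z.pow_1_l in EE by (try apply Z.pow_nonneg; lia).
  rewrite EE; ring.
Qed.

(** Newton's step: with [T n = v * P ^ (e + 1)], [k] is chosen to make [v + k * D'] vanish modulo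
    [P]. *)
Lemma hensel_step e c : 1 <= e -> 0 <= c -> (P ^ (e + 1) | T (n0 + c * M)) ->
  exists k, 0 <= k /\ (P ^ (e + 2) | T (n0 + c * M + k * (P ^ e * M))).
Proof.
intros e1 c0; set (n := n0 + c * M); intros [v vE]; pose proof (prime_ge_2 P pZ) as P2.
assert (Dn : ~ (P | D n)).
{ pose proof (T_mul_period P M 1 D D c n0 HD HD HM c0) as H.
  rewrite Z.pow_1_l, Z.mul_1_l in H by exact c0.
  exact (not_divide_sub _ _ _ H Dn0). }
destruct (T_add_period e n ltac:(lia)) as [D' [DD' HE]].
pose proof (not_divide_sub _ _ _ DD' Dn) as D'n.
destruct (rel_prime_bezout _ _ (prime_rel_prime _ pZ _ D'n)) as [w u uw].
(* Here [u] inverts [D'] modulo [P]; adding [P] ensures [1 <= k], as the expansion requires. *)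
set (k := (- v * u) mod P + P).
assert (k1 : P <= k) by (pose proof (Z.mod_pos_bound (- v * u) P ltac:(lia)); lia).
exists k; split; [lia|]; destruct (HE k ltac:(lia)) as [E EE]; rewrite EE, vE.
pose proof (Z_div_mod_eq_full (- v * u) P) as kE; set (q := - v * u / P) in kE.
assert (P_add : forall d, 0 <= d -> P ^ (d + 1) = P ^ d * P).
{ intros d d0; rewrite Z.pow_add_r by lia; ring. }
replace (e + 2) with (e + 1 + 1) by ring; rewrite !P_add by lia.
exists (v * w - q * D' + D' + P ^ e * E).
assert (kE' : k = - v * u - P * q + P) by (unfold k; lia); rewrite kE'.
replace v with (v * (w * P + u * D')) at 1 by (rewrite uw; ring); ring.
Qed.

(** All corrections are multiples of [P ^ e * M], so the class modulo [P ^ e * M] is never left. *)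
Lemma hensel_from e c m : 1 <= e -> 0 <= c -> (P ^ (e + 1) | T (n0 + c * M)) -> e <= m ->
  exists k, 0 <= k /\ (P ^ (m + 1) | T (n0 + c * M + k * (P ^ e * M))).
Proof.
intros e1 c0 He em; pose proof (prime_ge_2 P pZ) as P2.
replace m with (e + (m - e)) by ring; assert (d0 : 0 <= m - e) by lia.
revert d0; generalize (m - e); clear m em; intros d d0; pattern d.
apply natlike_ind; [| | exact d0]; clear d d0.
- exists 0; split; [lia|]; now rewrite Z.add_0_r, Z.mul_0_l, Z.add_0_r.
- intros d d0 [k [k0 Hk]].
  assert (Pd : 0 < P ^ d) by (apply Z.pow_pos_nonneg; lia).
  assert (Pe : 0 < P ^ e) by (apply Z.pow_pos_nonneg; lia).
  destruct (hensel_step (e + d) (c + k * P ^ e) ltac:(lia) ltac:(nia)) as [k' [k'0 Hk']].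
  { replace (n0 + _) with (n0 + c * M + k * (P ^ e * M)) by ring; exact Hk. }
  exists (k + k' * P ^ d); split; [nia|].
  replace (e + Z.succ d + 1) with (e + d + 2) by lia.
  replace (n0 + c * M + (k + k' * P ^ d) * (P ^ e * M))
    with (n0 + (c + k * P ^ e) * M + k' * (P ^ (e + d) * M))
    by (rewrite (Z.pow_add_r P e d) by lia; ring).
  exact Hk'.
Qed.

End PadicZero.

Lemma padic_zero_in_class (p : nat) (h N n0 Q : Z) (D : Z -> Z) :
  prime.prime p = true -> let P := Z.of_nat p in P = 2 * h + 1 -> 0 < N -> 0 < Q ->
  tribonacci D -> (forall n, T (n + N) = 1 * T n + P * D n) ->
  (P ^ 2 | T n0) -> ~ (P | D n0) ->
  exists b, forall m B, 0 <= m -> exists n,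
    B <= n /\ n mod Q = b mod Q /\ (P | n - n0) /\ (P ^ m | T n).
Proof.
intros pp P ph N0 Q0 HD HN Tn0 Dn0.
pose proof (prime_Z_of_nat p pp) as pZ; fold P in pZ; pose proof (prime_ge_2 P pZ) as P2.
destruct (exp_mul_ex P ltac:(lia) Q ltac:(lia)) as [e [Q' [QE PQ']]].
assert (Pe : 0 < P ^ Z.of_nat e) by (apply Z.pow_pos_nonneg; lia).
assert (Q'0 : 0 < Q') by nia.
(* The period absorbs the part of [Q] prime to [P]; [D] is then multiplied by [Q'] modulo [P], so
   the zero stays simple. *)
set (M := Q' * N).
assert (HM : forall n, exists E, T (n + M) = 1 * T n + P * (Q' * D n + P * E)).
{ intros n; destruct (T_add_mul N 1 P D HD HN (Q' - 1) ltac:(lia) n) as [E EE].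
  rewrite Z.sub_add, !Z.pow_1_l in EE by lia; exists E; unfold M; rewrite EE; ring. }
destruct (tribonacci_quot M 1 P ltac:(lia)) as [D' [HD' HM']].
{ intros n; destruct (HM n) as [E EE]; eexists; exact EE. }
assert (D'n0 : ~ (P | D' n0)).
{ apply (not_divide_sub _ _ (Q' * D n0)); [|now apply not_divide_mul].
  destruct (HM n0) as [E EE]; rewrite HM' in EE; exists E; nia. }
destruct (hensel_from p h M n0 D' pp ph HD' HM' D'n0 1 0 (Z.of_nat e + 1)
  ltac:(lia) ltac:(lia)) as [c [c0 Hc]]; [now rewrite Z.mul_0_l, Z.add_0_r | lia |].
fold P in Hc; rewrite Z.mul_0_l, Z.add_0_r, Z.pow_1_r in Hc.
(* From [b] on, corrections are multiples of [P ^ (e + 1) * M], hence of [P] and of [Q]. *)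
set (b := n0 + c * (P * M)) in Hc; exists b; intros m B m0.
destruct (hensel_from p h M n0 D' pp ph HD' HM' D'n0 (Z.of_nat e + 1) (c * P)
  (m + Z.of_nat e + 1) ltac:(lia) ltac:(nia)) as [k [k0 Hk]]; [| lia |].
{ fold P; replace (n0 + c * P * M) with b by (unfold b; ring); exact Hc. }
fold P in Hk; replace (n0 + c * P * M) with b in Hk by (unfold b; ring).
set (n := b + k * (P ^ (Z.of_nat e + 1) * M)) in Hk.
(* Adding [s] further periods carries the index beyond [B] and keeps [T] divisible by [P ^ m]. *)
set (s := Z.abs n + Z.abs B + 1).
assert (Pm : 0 < P ^ m) by (apply Z.pow_pos_nonneg; lia).
assert (P1 : P ^ (m + Z.of_nat e + 1) = P ^ m * P ^ Z.of_nat e * P).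
{ rewrite !Z.pow_add_r by lia; ring. }
destruct (T_add_period p h M D' pp ph HD' HM' (m + Z.of_nat e + 1) n ltac:(lia))
  as [Dn [_ HE]].
destruct (HE s ltac:(lia)) as [E EE]; fold P in EE.
exists (n + s * (P ^ (m + Z.of_nat e + 1) * M)); split; [|split; [|split]].
- assert (1 <= P ^ (m + Z.of_nat e + 1) * M) by (rewrite P1; unfold M; nia); nia.
- unfold n.
  replace (_ + _) with (b + (k * P * N + s * P ^ m * P * N) * Q).
  { now rewrite Z_mod_plus_full. }
  rewrite P1, QE, Z.pow_add_r, Z.pow_1_r by lia; unfold M; ring.
- unfold n, b; exists (c * M + k * P ^ Z.of_nat e * M + s * P ^ m * P ^ Z.of_nat e * M).
  rewrite P1, Z.pow_add_r, Z.pow_1_r by lia; ring.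
- rewrite EE; apply Z.divide_add_r; [|apply Z.divide_mul_l].
  all: replace (m + Z.of_nat e + 1 + 1) with (m + (Z.of_nat e + 2)) in * by ring.
  + eapply Z.divide_trans; [|exact Hk]; rewrite Z.pow_add_r by lia; apply Z.divide_factor_l.
  + rewrite Z.pow_add_r by lia; apply Z.divide_factor_l.
Qed.

Lemma vp_Some_inv (p k : nat) (z : Z) : prime.prime p = true -> vp p z = Some k ->
  exists u, z = Z.of_nat p ^ Z.of_nat k * u /\ ~ (Z.of_nat p | u).
Proof.
intros pp Hz; pose proof (prime_ge_2 _ (prime_Z_of_nat p pp)).
assert (z0 : z <> 0) by (intros ->; discriminate Hz).
destruct (exp_mul_ex (Z.of_nat p) ltac:(lia) z z0) as [k' [u [zE pu]]].
exists u; split; [|exact pu].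
rewrite zE, (vp_exp_mul p k' u pp pu) in Hz; injection Hz as <-; exact zE.
Qed.

Lemma vp_Some_ge (p k : nat) (m z : Z) : prime.prime p = true -> vp p z = Some k ->
  (Z.of_nat p ^ m | z) -> m <= Z.of_nat k.
Proof.
intros pp Hz Hm; pose proof (prime_ge_2 _ (prime_Z_of_nat p pp)).
destruct (vp_Some_inv p k z pp Hz) as [u [zE pu]].
destruct (Z.le_gt_cases m (Z.of_nat k)) as [|mk]; [assumption|exfalso; apply pu].
replace m with (Z.of_nat k + 1 + (m - Z.of_nat k - 1)) in Hm by ring.
rewrite !Z.pow_add_r, Z.pow_1_r in Hm by lia.
destruct Hm as [q E]; rewrite zE in E; exists (q * Z.of_nat p ^ (m - Z.of_nat k - 1)).
apply (Z.mul_reg_l _ _ (Z.of_nat p ^ Z.of_nat k)); [apply Z.pow_nonzero; lia | lia].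
Qed.

(** Near the zero the valuation of [T n] is unbounded, which excludes type (C) and in type (L)
    forces that of [n - a] to grow. *)
Lemma ML_integer_zero (p : nat) (h N n0 : Z) (D : Z -> Z) :
  prime.prime p = true -> let P := Z.of_nat p in P = 2 * h + 1 -> 0 < N ->
  tribonacci D -> (forall n, T (n + N) = 1 * T n + P * D n) ->
  (P ^ 2 | T n0) -> ~ (P | D n0) -> ML p ->
  exists a, forall m, 0 <= m -> exists n,
    a <= n /\ (P | n - n0) /\ (P ^ m | n - a) /\ (P ^ m | T n).
Proof.
intros pp P ph N0 HD HN Tn0 Dn0 [Q [Q0 HQ]].
pose proof (prime_ge_2 _ (prime_Z_of_nat p pp)) as P2; fold P in P2.
destruct (padic_zero_in_class p h N n0 Q D pp ph N0 Q0 HD HN Tn0 Dn0) as [b Hb]; fold P in Hb.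
destruct (HQ (b mod Q) ltac:(now apply Z.mod_pos_bound))
  as [[kappa [B HB]] | [a [kappa [mu [mu0 [_ [B HB]]]]]]].
- destruct (Hb (Z.of_nat kappa + 1) (Z.max 0 B) ltac:(lia)) as [n [Bn [nb [_ Tn]]]].
  pose proof (HB n ltac:(now rewrite Z.mod_mod by lia) ltac:(lia)) as vn.
  pose proof (vp_Some_ge p kappa _ _ pp vn Tn); lia.
- exists a; intros m m0.
  (* This precision forces the valuation of [n - a] to be at least [m]; the bound [Z.abs a + 1]
     keeps [n] different from [a]. *)
  destruct (Hb (Z.abs kappa + mu * m + m) (Z.max (Z.abs a + 1) B) ltac:(nia))
    as [n [Bn [nb [nP Tn]]]].
  pose proof (HB n ltac:(now rewrite Z.mod_mod by lia) ltac:(lia)) as vn.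
  assert (na : vp p (n - a) <> None).
  { unfold vp; destruct (Z.eqb_spec (n - a) 0); [lia | discriminate]. }
  destruct (vp p (n - a)) as [w|] eqn:Ew; [|congruence].
  destruct (vp p (T n)) as [v|] eqn:Ev; [|discriminate vn].
  cbn [option_map ext_affine] in vn; injection vn as vn.
  pose proof (vp_Some_ge p v _ _ pp Ev Tn) as vge.
  assert (mw : m <= Z.of_nat w) by nia.
  exists n; split; [lia|]; split; [exact nP|]; split.
  + destruct (vp_Some_inv p w _ pp Ew) as [u [-> _]]; fold P.
    replace (Z.of_nat w) with (m + (Z.of_nat w - m)) by ring.
    rewrite Z.pow_add_r by lia; do 2 apply Z.divide_mul_l; apply Z.divide_refl.
  + eapply Z.divide_trans; [|exact Tn].
    replace (_ + m) with (m + (Z.abs kappa + mu * m)) by ring.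
    rewrite Z.pow_add_r by nia; apply Z.divide_factor_l.
Qed.

(** * Nonvanishing of the two forms on [T] *)

(* If [x_i] is the coefficient of the root [a_i] in the solution of the recurrence with initial
   values [t0, t1, t2], then [cubic_form] is [44 x1 x2 x3] and [quadratic_form] is
   [22 (x1^2 + x2^2 + x3^2 - x1 x2 - x2 x3 - x1 x3)]. *)
Definition cubic_form (t0 t1 t2 : Z) : Z :=
  t0 ^ 3 + 2 * t1 ^ 3 + t2 ^ 3 + 2 * t0 * t1 ^ 2 + 2 * t0 ^ 2 * t1
  - t0 * t2 ^ 2 + t0 ^ 2 * t2 - 2 * t1 * t2 ^ 2 - 2 * t0 * t1 * t2.

Definition quadratic_form (t0 t1 t2 : Z) : Z :=
  t0 ^ 2 - 18 * t1 ^ 2 - 15 * t0 * t1 - 6 * t2 ^ 2 + 3 * t0 * t2 + 27 * t1 * t2.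

(** A shift multiplies the coefficients by the roots, whose product is 1, so the form is
    invariant. *)
Lemma cubic_form_T n : cubic_form (T n) (T (n + 1)) (T (n + 2)) = 1.
Proof.
pattern n; apply Z.bi_induction; [now intros ? ? -> | reflexivity |]; clear n; intros n.
rewrite <- Z.add_1_r; replace (n + 1 + 1) with (n + 2) by ring.
replace (n + 1 + 2) with (n + 3) by ring; rewrite T_tribonacci.
replace (cubic_form (T (n + 1)) (T (n + 2)) _) with (cubic_form (T n) (T (n + 1)) (T (n + 2)));
  [reflexivity | unfold cubic_form; ring].
Qed.

Lemma T_mod_period p M D n : tribonacci D -> 0 < M -> p <> 0 ->
  (forall n, T (n + M) = 1 * T n + p * D n) -> T n mod p = T (n mod M) mod p.
Proof.
intros HD M0 p0 HM.
assert (H : forall n k, 0 <= k -> T (n + k * M) mod p = T n mod p).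
{ clear n; intros n k k0; pose proof (T_mul_period p M 1 D T k n HD T_tribonacci HM k0) as [q E].
  rewrite Z.pow_1_l, Z.mul_1_l in E by exact k0.
  replace (T (n + k * M)) with (T n + q * p) by lia; apply Z_mod_plus_full. }
pose proof (Z_div_mod_eq_full n M) as E; destruct (Z.le_gt_cases 0 (n / M)) as [q0 | q0].
- rewrite <- (H (n mod M) (n / M) q0); do 2 f_equal; lia.
- rewrite <- (H n (- (n / M)) ltac:(lia)); do 2 f_equal; lia.
Qed.

(** Since 48 is a period of [T] modulo 7, it suffices to inspect 48 values modulo 7. *)
Lemma quadratic_form_T n : quadratic_form (T n) (T (n + 1)) (T (n + 2)) <> 0.
Proof.
destruct (scalar_mod_mul_add 7 1 7 (shift_pow 7 48) 48 ltac:(lia) (Z.divide_refl 7)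
  (represents_pow 7 48) ltac:(vm_compute; reflexivity)) as [D [HD HM]].
intros E; set (r := n mod 48).
assert (Hr : forall i, T (n + i) mod 7 = T (r + i) mod 7).
{ intros i; rewrite (T_mod_period 7 48 D (n + i) HD), (T_mod_period 7 48 D (r + i) HD)
    by lia || assumption.
  unfold r; now rewrite Zplus_mod_idemp_l. }
assert (H : (7 | quadratic_form (T r) (T (r + 1)) (T (r + 2)))).
{ assert (Hq : forall i, exists q, T (n + i) = T (r + i) + 7 * q).
  { intros i; exists (T (n + i) / 7 - T (r + i) / 7).
    pose proof (Z_div_mod_eq_full (T (n + i)) 7); pose proof (Z_div_mod_eq_full (T (r + i)) 7).
    specialize (Hr i); lia. }
  destruct (Hq 0) as [q0 E0], (Hq 1) as [q1 E1], (Hq 2) as [q2 E2].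
  rewrite !Z.add_0_r in E0; rewrite E0, E1, E2 in E; unfold quadratic_form in *.
  set (x := T r) in *; set (y := T (r + 1)) in *; set (z := T (r + 2)) in *.
  exists (- (2 * x * q0 + 7 * q0 ^ 2 - 18 * (2 * y * q1 + 7 * q1 ^ 2)
    - 15 * (x * q1 + y * q0 + 7 * q0 * q1) - 6 * (2 * z * q2 + 7 * q2 ^ 2)
    + 3 * (x * q2 + z * q0 + 7 * q0 * q2) + 27 * (y * q2 + z * q1 + 7 * q1 * q2))).
  match goal with |- ?L = _ => rewrite <- (Z.sub_0_r L), <- E end; ring. }
apply Z.mod_divide in H; [|lia].
assert (C : forallb (fun r => negb (quadratic_form (T r) (T (r + 1)) (T (r + 2)) mod 7 =? 0))
  (map Z.of_nat (seq 0 48)) = true) by (vm_compute; reflexivity).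
rewrite forallb_forall in C; specialize (C r); rewrite H in C; discriminate C.
apply in_map_iff; pose proof (Z.mod_pos_bound n 48 ltac:(lia)); fold r in H0.
exists (Z.to_nat r); split; [lia | apply in_seq; lia].
Qed.

(** * Transfer of the twisted zero theorem to [T] *)

Module Bridge.
Import all_boot all_order all_algebra zify.
Import GRing.Theory.

Lemma dvdn_int_of_Z (d : nat) (x : Z) : (Z.of_nat d | x) -> (d %| `|ssrZ.int_of_Z x|)%N.
Proof.
move=> [q qE]; apply/dvdnP; exists `|ssrZ.int_of_Z q|%N; nia.
Qed.

(** Applies [twisted_zero] to [T] started at [a]: the cubic form is 1 and the quadratic form is
    nonzero, which leaves only [T a = 0]. *)
Lemma integer_zero (p N : nat) (a : Z) : (1 < Z.of_nat p) -> (0 < Z.of_nat N) ->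
  (forall n, (Z.of_nat p | T (n + Z.of_nat N) - T n)) ->
  (forall m, (0 <= m) -> exists n, (a <= n) /\ (Z.of_nat p ^ m | n - a) /\
     (Z.of_nat p ^ m | T n)) ->
  T a = 0.
Proof.
move=> p1 N0 HN Ha.
pose u (k : nat) := ssrZ.int_of_Z (T (a + Z.of_nat k)).
(* [T] takes the required initial values 1, 0, 0 at -2, -1, 0. *)
pose tau (k : nat) := ssrZ.int_of_Z (T (Z.of_nat k - 2)).
have urec k : u k.+3 = (u k.+2 + u k.+1 + u k)%R.
  rewrite /u; have := T_tribonacci (a + Z.of_nat k).
  have -> : (a + Z.of_nat k + 3 = a + Z.of_nat k.+3) by lia.
  have -> : (a + Z.of_nat k + 2 = a + Z.of_nat k.+2) by lia.
  have -> : (a + Z.of_nat k + 1 = a + Z.of_nat k.+1) by lia.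
  lia.
have taurec k : tau k.+3 = (tau k.+2 + tau k.+1 + tau k)%R.
  rewrite /tau; have := T_tribonacci (Z.of_nat k - 2).
  have -> : (Z.of_nat k - 2 + 3 = Z.of_nat k.+3 - 2) by lia.
  have -> : (Z.of_nat k - 2 + 2 = Z.of_nat k.+2 - 2) by lia.
  have -> : (Z.of_nat k - 2 + 1 = Z.of_nat k.+1 - 2) by lia.
  lia.
have Hu m : exists2 k, (p ^ m %| k)%N & (p ^ m %| `|u k|)%N.
  have [n [an [na Tn]]] := Ha (Z.of_nat m) ltac:(lia).
  rewrite -Z_of_nat_expn in na Tn.
  exists (Z.to_nat (n - a)).
    have pm_gt0 : (0 < p ^ m)%N by rewrite expn_gt0; lia.
    case: na => q; move: (p ^ m)%N pm_gt0 => pm pm_gt0 qE.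
    have q0 : 0 <= q by nia.
    apply/dvdnP; exists (Z.to_nat q); rewrite qE Z2Nat.inj_mul; [|lia|lia].
    by rewrite Nat2Z.id multE.
  apply: dvdn_int_of_Z; rewrite Z2Nat.id; last by case: na => q; lia.
  by have -> : a + (n - a) = n by lia.
have dT (i : nat) (j : Z) : (Z.of_nat i - 2 = j) ->
    (p %| `|(tau (N + i)%N - ssrZ.int_of_Z (T j))%R|)%N.
  move=> jE; have -> : (tau (N + i)%N - ssrZ.int_of_Z (T j))%R =
      ssrZ.int_of_Z (T (j + Z.of_nat N) - T j).
    rewrite /tau; have -> : Z.of_nat (N + i)%N - 2 = j + Z.of_nat N by lia.
    by lia.
  exact/dvdn_int_of_Z/HN.
have uE : [/\ u 0%N = ssrZ.int_of_Z (T a), u 1%N = ssrZ.int_of_Z (T (a + 1)) &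
    u 2%N = ssrZ.int_of_Z (T (a + 2))] by rewrite /u /= Z.add_0_r.
have [u0 u1 u2] := uE.
case: (@TwistedZero.twisted_zero u tau p N _ _ urec erefl erefl erefl taurec _ _ _ Hu _).
- by lia.
- by lia.
- by have := dT 0%N (-2) erefl; rewrite addn0.
- by have := dT 1%N (-1) erefl; rewrite addn1 subr0.
- by have := dT 2%N 0 erefl; rewrite addn2 subr0.
- by have := cubic_form_T a; rewrite /cubic_form u0 u1 u2; lia.
- by rewrite u0; lia.
by have := quadratic_form_T a; rewrite /quadratic_form u0 u1 u2; lia.
Qed.

End Bridge.
Import Bridge.

(** * Simple [p]-adic zeros not congruent to the integral ones *)

Definition certificates : list (positive * positive * positive) :=
  [(5, 31, 52); (7, 48, 197); (13, 168, 342); (17, 96, 1180); (19, 360, 2178);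
   (23, 553, 5006); (29, 140, 3997); (31, 331, 7958); (37, 469, 14558); (41, 560, 10675);
   (43, 308, 12094); (47, 46, 721); (53, 52, 917); (59, 3541, 102753); (61, 1860, 13088);
   (67, 1519, 45670); (71, 5113, 5245); (73, 5328, 5359); (79, 3120, 131058);
   (89, 8011, 616956); (97, 3169, 304243); (101, 680, 14466); (107, 1272, 14176);
   (109, 990, 79305); (113, 12883, 889099); (127, 5376, 91978); (131, 5720, 371879);
   (137, 18907, 2476828); (139, 3864, 247330); (149, 7400, 481010); (151, 2850, 125623);
   (157, 8269, 893123); (167, 9296, 799497); (173, 2494, 20266); (179, 32221, 451194);
   (181, 10981, 1350688); (191, 36673, 5170965); (193, 4656, 842907); (197, 3234, 97402);
   (199, 198, 36656); (211, 5565, 528758); (223, 16651, 2431407); (227, 17176, 2713842);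
   (229, 17557, 2159760); (233, 9048, 1438668); (239, 4760, 157108); (241, 29040, 5082506);
   (251, 63253, 10437049); (257, 256, 5174); (263, 23056, 5948485); (269, 268, 24029);
   (271, 73440, 12191371); (277, 12788, 652249); (281, 13160, 447976);
   (283, 13348, 1442361); (293, 28616, 5380266); (307, 31416, 6754470); (311, 310, 20273);
   (313, 32761, 4979701); (317, 100807, 15121086); (331, 36631, 4029598);
   (337, 16224, 2774624); (347, 40136, 3331444); (349, 17400, 5952228);
   (353, 124963, 36989143); (359, 42960, 1547764); (367, 45019, 2521756);
   (373, 139128, 12660927); (379, 48007, 2832722); (383, 147073, 17501906);
   (389, 151711, 25944320); (401, 400, 53465); (409, 41820, 9200765); (419, 418, 58379);
   (421, 420, 136618); (431, 61920, 23530065); (433, 62641, 17539865);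
   (439, 6424, 1234189); (443, 196693, 76907479); (449, 202051, 24650329);
   (457, 34808, 13854442); (461, 35420, 6234112); (463, 71611, 8164278);
   (467, 218557, 44149783); (479, 76480, 11013176); (487, 79219, 27647562);
   (491, 10045, 372467); (499, 166, 55221); (503, 42168, 7379507); (509, 259591, 57890021);
   (521, 271963, 66904956); (523, 273528, 60449925); (541, 58536, 59169);
   (547, 149604, 9574760); (557, 103416, 26371589); (563, 52828, 13524055);
   (569, 53960, 26980322); (571, 40755, 4931882); (577, 111169, 36241455);
   (587, 293, 114659); (593, 3256, 1482329); (599, 598, 222115)]%positive.
(* In an entry [(p, N, n0)], [N] is a period of [T] modulo [p], [p^2] divides [T n0] but not
   [T (n0 + N)], so Hensel lifting yields a [p]-adic zero congruent to [n0] modulo [p]. *)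
Definition check_certificate (c : positive * positive * positive) : bool :=
  let '(p, N, n0) := c in
  let m := Zpos p * Zpos p in
  let t := shift_pow m N in
  let t0 := shift_pow m n0 in
  (scalar_mod (Zpos p) 1 t && (act t0 0 mod m =? 0)
    && negb (act (mul_mod m t t0) 0 mod m =? 0)
    && forallb (fun a => negb ((Zpos n0 - a) mod Zpos p =? 0)) zeros)%bool.

Lemma certificates_ok : forallb check_certificate certificates = true.
Proof. vm_compute; reflexivity. Qed.

Lemma certificates_complete : forallb (fun p => (negb (prime.prime p)
    || existsb (Nat.eqb p) [11; 83; 103; 163; 397]
    || existsb (fun '(q, _, _) => Pos.to_nat q =? p) certificates)%bool)%nat
  (seq 5 595) = true.
Proof. vm_compute; reflexivity. Qed.

Lemma not_ML_of_certificate (q : positive) (h : Z) (N n0 : positive) :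
  let p := Pos.to_nat q in prime.prime p = true -> Zpos q = 2 * h + 1 ->
  check_certificate (q, N, n0) = true -> ~ ML p.
Proof.
intros p pp; assert (pq : Z.of_nat p = Zpos q) by apply positive_nat_Z.
unfold check_certificate; rewrite <- pq; set (P := Z.of_nat p) in *; intros ph.
rewrite !Bool.andb_true_iff, forallb_forall; intros [[[Hs H0] HN] Hz] HML.
pose proof (prime_ge_2 _ (prime_Z_of_nat p pp)) as P2; fold P in P2.
pose proof (represents_pow (P * P) N) as RN; pose proof (represents_pow (P * P) n0) as R0.
rewrite (T_eq_mod _ _ _ 0 (represents_mul _ _ _ _ _ RN R0)) in HN.
rewrite (T_eq_mod _ _ _ 0 R0), Z.add_0_l in H0.
destruct (scalar_mod_mul_add P 1 (P * P) _ (Zpos N) ltac:(lia) (Z.divide_factor_l _ _) RN Hs)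
  as [D [HD HM]].
assert (Tn0 : (P ^ 2 | T (Zpos n0))).
{ rewrite Z.pow_2_r; apply Z.mod_divide; [nia | now apply Z.eqb_eq]. }
(* Otherwise [P ^ 2] would divide [T (n0 + N) = T n0 + P * D n0]. *)
assert (Dn0 : ~ (P | D (Zpos n0))).
{ intros [w E]; rewrite Z.add_0_l, Z.add_comm, HM, E in HN.
  destruct Tn0 as [v vE]; rewrite vE in HN.
  replace (1 * (v * P ^ 2) + P * (w * P)) with ((v + w) * (P * P)) in HN by ring.
  now rewrite Z_mod_mult in HN. }
destruct (ML_integer_zero p h (Zpos N) (Zpos n0) D pp ph ltac:(lia) HD HM Tn0 Dn0 HML)
  as [a Ha]; fold P in Ha.
assert (Ta : T a = 0).
{ apply (integer_zero p (Pos.to_nat N)).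
  - fold P; lia.
  - lia.
  - intros n; rewrite positive_nat_Z, HM; exists (D n); fold P; ring.
  - intros m m0; destruct (Ha m m0) as [n [an [_ H]]]; exists n; split; [exact an | exact H]. }
pose proof (Hz a (T_eq_0 a Ta)) as Hza.
(* Some [n] is congruent modulo [P] to both [a] and [n0], whereas the certificate separates [n0]
   from all zeros. *)
destruct (Ha 1 ltac:(lia)) as [n [_ [Hn [Hna _]]]]; rewrite Z.pow_1_r in Hna.
apply (fun H => Z.divide_sub_r _ _ _ H Hn) in Hna.
replace (n - a - (n - Zpos n0)) with (Zpos n0 - a) in Hna by ring.
apply Z.mod_divide in Hna; [|lia].
now rewrite Hna in Hza.
Qed.

Theorem theorem5 :
  (forall p : nat, prime.prime p = true -> (5 <= p <= 599)%nat ->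
     ~ In p [11; 83; 103; 163; 397]%nat -> ~ ML p)
  /\
  (forall (p : nat) (Q : Z), (p = 83%nat /\ Q = 287) \/ (p = 397%nat /\ Q = 132) ->
     ML p /\
     forall n : Z,
       (forall a : Z, In a [0; -1; -4; -17] -> n mod Q = a mod Q ->
          vp p (T n) = option_map S (vp p (n - a))) /\
       ((forall a : Z, In a [0; -1; -4; -17] -> n mod Q <> a mod Q) ->
          vp p (T n) = Some 0%nat)).
Proof.
split.
- intros p pp p599 pex.
  pose proof certificates_complete as C; rewrite forallb_forall in C.
  specialize (C p ltac:(apply in_seq; lia)); rewrite pp in C; cbn [negb orb] in C.
  apply Bool.orb_true_iff in C; destruct C as [C | C].
  + apply existsb_exists in C; destruct C as [r [Hr pr]].
    apply Nat.eqb_eq in pr; subst r; contradiction.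
  + apply existsb_exists in C; destruct C as [[[q N] n0] [Hc Eq]].
    apply Nat.eqb_eq in Eq; subst p.
    pose proof certificates_ok as Cok; rewrite forallb_forall in Cok.
    pose proof (prime_Z_of_nat _ pp) as pZ; rewrite positive_nat_Z in pZ.
    destruct (Z.Even_or_Odd (Zpos q)) as [[h ph] | [h ph]].
    * destruct (prime_divisors _ pZ 2) as [H | [H | [H | H]]]; try lia.
      exists h; lia.
    * exact (not_ML_of_certificate q h N n0 pp ph (Cok _ Hc)).
- intros p Q HpQ; pose proof (valuation_formula_83_397 p Q HpQ) as H; split; [|exact H].
  apply (ML_of_valuation_formula p Q); [| | exact H].
  + lia.
  + destruct HpQ as [[-> ->] | [-> ->]]; vm_compute; reflexivity.
Qed.
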